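(* Let $d\ge1$ and let $f\in L^2(\mathbb{R}^d)$ (so that its Wigner distribution satisfies $Wf\in L^2(\mathbb{R}^{2d})$). Let $(z,\zeta)\in\mathbb{R}^{2d}\times\mathbb{R}^{2d}$, with $\zeta=(\zeta_1,\zeta_2)\in\mathbb{R}^d\times\mathbb{R}^d$ satisfying $\zeta_1\cdot\zeta_2\neq 0$. Then $$(z,\zeta)\notin WF_{H^2}(Qf),$$ where $Qf$ is the Born-Jordan distribution of $f$.
   Context: Notation: $x\omega=x\cdot\omega$ is the Euclidean scalar product, $\langle\omega\rangle=(1+|\omega|^2)^{1/2}$, and $\mathcal{S}'$ is the space of temperate distributions. Fourier transforms: $\mathcal{F}f(\omega)=\widehat f(\omega)=\int e^{-2\pi i x\omega}f(x)\,dx$. The symplectic Fourier transform of a function (or, by extension, temperate distribution) $F$ on $\mathbb{R}^{2d}$ is $\mathcal{F}_\sigma F(\zeta)=\mathcal{F}F(J\zeta)$, where $J(\zeta_1,\zeta_2)=(\zeta_2,-\zeta_1)$ for $\zeta=(\zeta_1,\zeta_2)\in\mathbb{R}^d\times\mathbb{R}^d$. It is an involution and satisfies $\mathcal{F}_\sigma[F\ast G]=\mathcal{F}_\sigma F\,\mathcal{F}_\sigma G$. Wigner distribution: $Wf(x,\omega)=\int_{\mathbb{R}^d} f(x+\frac y2)\overline{f(x-\frac y2)}e^{-2\pi i y\omega}\,dy$, $x,\omega\in\mathbb{R}^d$. Born-Jordan distribution: $Qf=Wf\ast\Theta_\sigma$, where $\Theta(\zeta_1,\zeta_2)=\frac{\sin(\pi\zeta_1\cdot\zeta_2)}{\pi\zeta_1\cdot\zeta_2}$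 for $(\zeta_1,\zeta_2)\in\mathbb{R}^d\times\mathbb{R}^d$ (with value $1$ where $\zeta_1\cdot\zeta_2=0$) and $\Theta_\sigma=\mathcal{F}_\sigma\Theta$. Equivalently, $Qf=\mathcal{F}_\sigma(\Theta\cdot\mathcal{F}_\sigma Wf)$, the product being well defined in $\mathcal{S}'(\mathbb{R}^{2d})$ because $\Theta$ is smooth with all derivatives of at most polynomial growth. Sobolev wave-front set: let $s\in\mathbb{R}$ and let $F$ be a distribution on $\mathbb{R}^n$. The set $WF_{H^s}(F)\subset\mathbb{R}^n\times(\mathbb{R}^n\setminus\{0\})$ is the set of points $(x_0,\omega_0)$, $\omega_0\neq0$, for which the following condition is not satisfied: for some $\varphi\in C^\infty_c(\mathbb{R}^n)$ with $\varphi(x_0)\neq0$ and some open conic neighborhood $\Gamma\subset\mathbb{R}^n\setminus\{0\}$ of $\omega_0$, one has $\|\mathcal{F}[\varphi F](\omega)\langle\omega\rangle^s\|_{L^2(\Gamma)}<\infty$. Here $n=2d$ and $s=2$. Having $(z,\zeta)\notin WF_{H^2}(Qf)$ is expressed by saying that $Qf$ has regularity $H^2$ at $z$ and in the direction $\zeta$. *)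

(* Defs.v *)
From HB Require Import structures.
From mathcomp Require Import all_boot all_order all_algebra.
From mathcomp Require Import complex.
From mathcomp Require Import all_classical all_reals all_analysis.

Set Implicit Arguments.
Unset Strict Implicit.
Unset Printing Implicit Defensive.

Import Order.TTheory GRing.Theory Num.Theory.
Import numFieldNormedType.Exports.
Import Normc.

Local Open Scope classical_set_scope.
Local Open Scope complex_scope.
Local Open Scope ring_scope.

(* The points of R^n are the row vectors 'rV[R]_n. They carry the product
   sigma-algebra (the Borel sets, when T is the real line). *)
Section measurable_rV.
Context d (T : measurableType d) (n : nat).

Definition rV_coord (i : 'I_n) (v : 'rV[T]_n) : T := v ord0 i.

Let rV_set0 : g_sigma_preimage rV_coord set0.
Proof. exact: sigma_algebra0. Qed.

Let rV_setC A : g_sigma_preimage rV_coord A -> g_sigma_preimage rV_coord (~` A).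
Proof. exact: sigma_algebraC. Qed.

Let rV_bigcup (F : _^nat) : (forall i, g_sigma_preimage rV_coord (F i)) ->
  g_sigma_preimage rV_coord (\bigcup_i (F i)).
Proof. exact: sigma_algebra_bigcup. Qed.

HB.instance Definition _ := @isMeasurable.Build (measure_tuple_display d)
  'rV[T]_n (g_sigma_preimage rV_coord) rV_set0 rV_setC rV_bigcup.

Lemma measurable_rV_coord (i : 'I_n) : measurable_fun setT (rV_coord i).
Proof.
move=> _ Y mY; rewrite setTI; apply: sub_sigma_algebra => /=.
rewrite -bigcup_seq/=; exists i => /=; first by rewrite mem_index_enum.
by exists Y => //; rewrite setTI.
Qed.

Lemma measurable_fun_rV d1 (T1 : measurableType d1) (f : T1 -> 'rV[T]_n) :
  (forall i, measurable_fun setT (rV_coord i \o f)) -> measurable_fun setT f.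
Proof.
move=> mf _ A mA.
suff : preimage_set_system setT f measurable `<=` measurable.
  by apply; exists A.
have -> : preimage_set_system setT f (measurable : set (set 'rV[T]_n)) =
    g_sigma_preimage (fun i => rV_coord i \o f).
  by rewrite g_sigma_preimage_comp.
apply: smallest_sub; first exact: sigma_algebra_measurable.
rewrite -bigcup_seq => B [i _ [Y mY <-]]; exact: mf.
Qed.

End measurable_rV.

Section lebesgue_rV.
Context {R : realType}.

Definition rV_cons n (p : measurableTypeR R * 'rV[R]_n) : 'rV[R]_n.+1 :=
  row_mx (const_mx p.1 : 'rV[R]_1) p.2.

Lemma rV_consK n (v : 'rV[R]_n.+1) :
  rV_cons (v ord0 ord0, rsubmx (v : 'rV[R]_(1 + n))) = v.
Proof.
rewrite -[RHS](@hsubmxK _ 1 1 n) /rV_cons/=; set w := rsubmx _.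
suff -> : const_mx (v ord0 ord0) = lsubmx (v : 'rV[R]_(1 + n)) by [].
by apply/rowP => j; rewrite !mxE; congr (v _ _); apply/val_inj; rewrite /= ord1.
Qed.

Lemma rsubmx_rV_cons n (p : measurableTypeR R * 'rV[R]_n) :
  rsubmx (rV_cons p : 'rV[R]_(1 + n)) = p.2.
Proof. exact: row_mxKr. Qed.

Lemma rV_cons0 n (p : measurableTypeR R * 'rV[R]_n) :
  rV_cons p ord0 ord0 = p.1.
Proof.
have E : ord0 = lshift n (ord0 : 'I_1) :> 'I_n.+1 by apply/val_inj.
rewrite [X in rV_cons p _ X]E.
by rewrite (row_mxEl (const_mx p.1 : 'rV[R]_1) p.2) mxE.
Qed.

Lemma rV_consS n (p : measurableTypeR R * 'rV[R]_n) (j : 'I_n) :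
  rV_cons p ord0 (rshift 1 j) = p.2 ord0 j.
Proof. exact: (row_mxEr (const_mx p.1 : 'rV[R]_1) p.2). Qed.

Lemma measurable_rV_cons n : measurable_fun setT (@rV_cons n).
Proof.
apply: measurable_fun_rV => i.
have [j ->|j ->] := split_ordP (i : 'I_(1 + n)).
  rewrite (_ : _ \o _ = fst); first exact: measurable_fst.
  by apply/funext => p; rewrite /= /rV_coord (row_mxEl (const_mx p.1 : 'rV[R]_1)) mxE.
rewrite (_ : _ \o _ = rV_coord j \o snd).
  exact: (measurableT_comp (measurable_rV_coord j) measurable_snd).
by apply/funext => p; rewrite /= /rV_coord rV_consS.
Qed.

Section lebesgue_rV_succ.
Context n (mu : {sigma_finite_measure set 'rV[R]_n -> \bar R}).

Definition lebesgue_rV_succ : set 'rV[R]_n.+1 -> \bar R :=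
  pushforward (lebesgue_measure \x mu)%E (@rV_cons n).

Let m : {measure set 'rV[R]_n.+1 -> \bar R}.
Proof.
refine (pushforward (lebesgue_measure \x mu)%E (@rV_cons n)).
exact: measurable_rV_cons.
Defined.

HB.instance Definition _ := isMeasure.Build _ _ _ lebesgue_rV_succ
  (measure0 m) (measure_ge0 m) (@measure_semi_sigma_additive _ _ _ m).

Let m_sigma_finite : sigma_finite setT lebesgue_rV_succ.
Proof.
have /sigma_finiteP[F [TF ndF Foo]] := sigma_finiteT (@lebesgue_measure R).
have /sigma_finiteP[G [TG ndG Goo]] := sigma_finiteT mu.
pose u (v : 'rV[R]_n.+1) : measurableTypeR R * 'rV[R]_n :=
  (v ord0 ord0, rsubmx (v : 'rV[R]_(1 + n))).
have uK q : u (rV_cons q) = q.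
  by rewrite /u rV_cons0 rsubmx_rV_cons; case: q.
have mu_ : measurable_fun setT u.
  apply/measurable_fun_pairP; split; first exact: (@measurable_rV_coord _ R).
  apply: measurable_fun_rV => j.
  rewrite (_ : _ \o _ = rV_coord (rshift 1 j : 'I_n.+1)).
    exact: measurable_rV_coord.
  by apply/funext => v; rewrite /= /rV_coord mxE.
exists (fun k => u @^-1` (F k `*` G k)).
  rewrite -preimage_bigcup; apply/esym; rewrite -[RHS](preimage_setT u).
  congr (u @^-1` _); apply/seteqP; split => // -[x y] _.
  have [i _ Fix] : (\bigcup_i F i) x by rewrite -TF.
  have [j _ Gjy] : (\bigcup_i G i) y by rewrite -TG.
  exists (maxn i j) => //; split => /=.
    by move: x Fix; exact/subsetPset/ndF/leq_maxl.
  by move: y Gjy; exact/subsetPset/ndG/leq_maxr.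
move=> k; have [mF Fk] := Foo k; have [mG Gk] := Goo k; split.
  by rewrite -[X in measurable X]setTI; apply: mu_ => //; exact: measurableX.
rewrite /lebesgue_rV_succ /pushforward -comp_preimage.
rewrite (_ : u \o _ = id); last exact/funext.
by rewrite preimage_id product_measure1E// lte_mul_pinfty// ge0_fin_numE.
Qed.

HB.instance Definition _ := Measure_isSigmaFinite.Build _ _ _ lebesgue_rV_succ
  m_sigma_finite.

End lebesgue_rV_succ.

Fixpoint lebesgue_rV n : {sigma_finite_measure set 'rV[R]_n -> \bar R} :=
  if n is m.+1 return {sigma_finite_measure set 'rV[R]_n -> \bar R}
  then lebesgue_rV_succ (lebesgue_rV m)
  else @dirac _ 'rV[R]_0 0 R.

End lebesgue_rV.

Section definitions.
Context {R : realType}.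
Local Notation C := R[i].

Definition dot n (x y : 'rV[R]_n) : R := \sum_i x ord0 i * y ord0 i.

Definition japanese n (w : 'rV[R]_n) : R := Num.sqrt (1 + dot w w).

Definition expi (t : R) : C := cos t +i* sin t.

Definition cintegral n (g : 'rV[R]_n -> C) : C :=
  (\int[lebesgue_rV n]_x complex.Re (g x)) +i*
  (\int[lebesgue_rV n]_x complex.Im (g x)).

Definition L2norm n (A : set 'rV[R]_n) (g : 'rV[R]_n -> C) : \bar R :=
  ('N[lebesgue_rV n]_2%:E[(fun x => (normc (g x))%:E) \_ A])%E.

Definition square_integrable n (f : 'rV[R]_n -> C) : Prop :=
  [/\ measurable_fun setT (fun x => complex.Re (f x)),
      measurable_fun setT (fun x => complex.Im (f x)) &
      (L2norm setT f < +oo)%E].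

Definition partial n (i : 'I_n) (g : 'rV[R]_n -> R) : 'rV[R]_n -> R :=
  fun x => 'D_(delta_mx ord0 i) g x.

Definition iter_partial n (s : seq 'I_n) (g : 'rV[R]_n -> R) :=
  foldr (@partial n) g s.

Definition smooth n (g : 'rV[R]_n -> R) : Prop :=
  forall s : seq 'I_n, continuous (iter_partial s g) /\
    forall i x, derivable (iter_partial s g) x (delta_mx ord0 i).

Definition csmooth n (g : 'rV[R]_n -> C) : Prop :=
  smooth (fun x => complex.Re (g x)) /\ smooth (fun x => complex.Im (g x)).

Definition test_function n (phi : 'rV[R]_n -> C) : Prop :=
  csmooth phi /\ compact (closure [set x | phi x != 0]).

Definition fourier n (phi : 'rV[R]_n -> C) : 'rV[R]_n -> C :=
  fun w => cintegral (fun x => expi (- (2 * pi * dot x w)) * phi x).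

(* A distribution is represented by its action phi |-> <F, phi>. The functionals
   below are given by integral formulas that make sense (with the default value
   of a divergent integral) for every function phi; their values are meaningful
   on Schwartz functions, where they are those of the temperate distribution. *)
Definition distribution n := ('rV[R]_n -> C) -> C.

Definition distr_of_fun n (g : 'rV[R]_n -> C) : distribution n :=
  fun phi => cintegral (fun x => g x * phi x).

Definition distr_mul n (m : 'rV[R]_n -> C) (F : distribution n) :
  distribution n := fun phi => F (fun x => m x * phi x).

Definition distr_fourier n (F : distribution n) : distribution n :=
  fun phi => F (fourier phi).

(* <F * G, phi> = <F_x, <G_y, phi (x + y)>>, the convolution of a temperate
   distribution F with a rapidly decreasing one G, such as the Fourier transform
   of a smooth function all of whose derivatives have polynomial growth. *)
Definition distr_convolution n (F G : distribution n) : distribution n :=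
  fun phi => F (fun x => G (fun y => phi (x + y))).

(* The Fourier transform of a compactly supported distribution F is the function
   w |-> <F, exp (- 2 pi i x w)>. *)
Definition fourier_compact n (F : distribution n) : 'rV[R]_n -> C :=
  fun w => F (fun x => expi (- (2 * pi * dot x w))).

Definition conic n (G : set 'rV[R]_n) : Prop :=
  forall (t : R) w, 0 < t -> G w -> G (t *: w).

Definition regular_at n (s : R) (F : distribution n) (x0 w0 : 'rV[R]_n) : Prop :=
  exists2 phi : 'rV[R]_n -> C, test_function phi /\ phi x0 != 0 &
  exists2 G : set 'rV[R]_n, [/\ open G, conic G, ~ G 0 & G w0] &
    (L2norm G (fun w => (fourier_compact (distr_mul phi F) w *
                         (japanese w `^ s)%:C)%R) < +oo)%E.

Definition wave_front_Hs n (s : R) (F : distribution n) :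
    set ('rV[R]_n * 'rV[R]_n) :=
  [set p | p.2 != 0 /\ ~ regular_at s F p.1 p.2].

Section phase_space.
Variable d : nat.
Implicit Types z : 'rV[R]_(d + d).

Definition symplectic z : 'rV[R]_(d + d) := row_mx (rsubmx z) (- lsubmx z).

Definition symplectic_inv z : 'rV[R]_(d + d) := row_mx (- rsubmx z) (lsubmx z).

Lemma symplecticK : cancel symplectic symplectic_inv.
Proof.
by move=> z; rewrite /symplectic_inv row_mxKl row_mxKr opprK hsubmxK.
Qed.

Lemma symplectic_invK : cancel symplectic_inv symplectic.
Proof.
by move=> z; rewrite /symplectic row_mxKl row_mxKr opprK hsubmxK.
Qed.

(* F (J z) is the pull-back of F by J, which preserves Lebesgue measure:
   <F \o J, phi> = <F, phi \o J^-1>. *)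
Definition distr_symplectic_fourier (F : distribution (d + d)) :
  distribution (d + d) := fun phi => distr_fourier F (phi \o symplectic_inv).

Definition wigner (f : 'rV[R]_d -> C) : 'rV[R]_(d + d) -> C := fun z =>
  let x := lsubmx z in let w := rsubmx z in
  cintegral (fun y : 'rV[R]_d =>
    f (x + 2^-1 *: y) * conjc (f (x - 2^-1 *: y)) *
    expi (- (2 * pi * dot y w))).

Definition sinc (t : R) : R := if t == 0 then 1 else sin (pi * t) / (pi * t).

Definition Theta : 'rV[R]_(d + d) -> C :=
  fun z => (sinc (dot (lsubmx z) (rsubmx z)))%:C.

Definition Theta_sigma : distribution (d + d) :=
  distr_symplectic_fourier (distr_of_fun Theta).

Definition born_jordan (f : 'rV[R]_d -> C) : distribution (d + d) :=
  distr_convolution (distr_of_fun (wigner f)) Theta_sigma.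

End phase_space.
End definitions.

(* Main.v *)
Require Import Defs.
From mathcomp Require Import all_boot all_order all_algebra.
From mathcomp Require Import complex.
From mathcomp Require Import all_classical all_reals all_analysis.
From mathcomp Require Import measurable_realfun.
From mathcomp Require Import ring lra.

(** In the Fourier variable, the localisation of [Qf] by a cut-off [phi] reads
    w |-> int (Wf)^(v) Theta(v) phi^(w - v) dv.
    On a cone where |w1.w2| >= c |w|^2 one has
    <w>^2 |Theta(v)| <= K <w - v>^2, since |v1.v2| controls |w|^2 up to
    |w - v|^2 and |v1.v2| |Theta(v)| <= 1. As <.>^2 phi^ is integrable, <w>^2
    times the integral is in L^2 of the cone by Schur's test, provided that
    Wf is in L^2. Only Bessel's inequality for the Fourier transform is needed:
    it is proved by regularising with a tensor bump function, it yields
    Wf in L^2 (apply it in the second variable of f(x + y/2) conj f(x - y/2)),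
    and the pairing of Wf with a Fourier transform is the limit of the pairings
    of its truncations, to which Fubini's theorem applies. *)

(** The exponent 2 comes from |v1.v2| being quadratic in v: a decay of order one in v1.v2 is worth
    two derivatives where |v1.v2| is comparable with |v|^2. The obstacle is that Wf is only known to
    be in L^2, while [fourier] is a plain integral with a default value where it diverges, so (Wf)^
    is not at hand as a function. Its role is played by the transforms of truncations of Wf, whose
    L^2 norms are bounded uniformly. The truncation error tends to 0 for each w but with no
    uniformity in w: the limit is therefore taken pointwise, as an inferior limit of squares, and
    Fatou's lemma carries the bound over to the norm. The cut-off may be chosen freely as long as it
    does not vanish at z. A product of one-variable bumps has a product as its Fourier transform,
    and four integrations by parts bound each factor by a multiple of (1 + s^2)^-2. Half of this
    decay pays for <w - v>^2, the other half gives integrability. *)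

Set Implicit Arguments.
Unset Strict Implicit.
Unset Printing Implicit Defensive.

Import Order.TTheory GRing.Theory Num.Theory.
Import numFieldNormedType.Exports.
Import Normc.

Local Open Scope classical_set_scope.
Local Open Scope complex_scope.
Local Open Scope ring_scope.

(** * Integrals of complex functions *)

Section complex_lemmas.
Context {R : rcfType}.
Implicit Types z w : R[i].

Lemma normc_ge0 z : 0 <= normc z.
Proof. by case: z => a b; rewrite sqrtr_ge0. Qed.

Lemma sqr_normcE z : normc z ^+ 2 = complex.Re z ^+ 2 + complex.Im z ^+ 2.
Proof. by case: z => a b /=; rewrite sqr_sqrtr// addr_ge0// sqr_ge0. Qed.

Lemma ler_normcP z (a : R) : 0 <= a -> normc z ^+ 2 <= a ^+ 2 -> normc z <= a.
Proof. by move=> a0; rewrite ler_pXn2r// nnegrE normc_ge0. Qed.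

Lemma normr_Re_le z : `|complex.Re z| <= normc z.
Proof.
by rewrite -(@ler_pXn2r _ 2)// ?nnegrE ?normc_ge0// sqr_normcE real_normK ?num_real//
  lerDl sqr_ge0.
Qed.

Lemma normr_Im_le z : `|complex.Im z| <= normc z.
Proof.
by rewrite -(@ler_pXn2r _ 2)// ?nnegrE ?normc_ge0// sqr_normcE real_normK ?num_real//
  lerDr sqr_ge0.
Qed.

Lemma Re_mulc z w : complex.Re (z * w) =
  complex.Re z * complex.Re w - complex.Im z * complex.Im w.
Proof. by case: z w => a b [c d]. Qed.

Lemma Im_mulc z w : complex.Im (z * w) =
  complex.Re z * complex.Im w + complex.Im z * complex.Re w.
Proof. by case: z w => a b [c d]. Qed.

Lemma normc_conj z : normc (conjc z) = normc z.
Proof. by case: z => a b /=; rewrite sqrrN. Qed.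

Lemma normc_real (a : R) : normc a%:C = `|a|.
Proof. by rewrite /normc/= expr0n/= addr0 sqrtr_sqr. Qed.

Lemma mul_conjc z : z * conjc z = (normc z ^+ 2)%:C.
Proof.
rewrite sqr_normcE; case: z => a b; apply/eqP; rewrite eq_complex/=.
by apply/andP; split; apply/eqP; ring.
Qed.

Lemma normc_prod (I : Type) (s : seq I) (F : I -> R[i]) :
  normc (\prod_(i <- s) F i) = \prod_(i <- s) normc (F i).
Proof.
by elim/big_rec2 : _ => [|i x y _ <-]; [exact: normc1|rewrite normcM].
Qed.

End complex_lemmas.

Section expi.
Context {R : realType}.
Implicit Types t u : R.

Lemma normc_expi t : normc (expi t) = 1.
Proof. by rewrite /normc/= cos2Dsin2 sqrtr1. Qed.

Lemma expiD t u : expi (t + u) = expi t * expi u.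
Proof.
apply/eqP; rewrite eq_complex Re_mulc Im_mulc/= cosD sinD eqxx/=.
by apply/eqP; ring.
Qed.

Lemma expi0 : expi (0 : R) = 1.
Proof. by rewrite /expi cos0 sin0. Qed.

Lemma conjc_expi t : conjc (expi t) = expi (- t).
Proof. by rewrite /expi/= cosN sinN. Qed.

Lemma expi_sum (I : Type) (s : seq I) (F : I -> R) :
  expi (\sum_(i <- s) F i) = \prod_(i <- s) expi (F i).
Proof.
by elim/big_rec2 : _ => [|i x y _ <-]; [exact: expi0|rewrite expiD].
Qed.

End expi.

(** The integral of a nonnegative function is a supremum over the simple functions below it, so
    monotonicity holds for arbitrary functions. This covers integrands whose measurability is not
    established, such as the localised transform in [L2norm_lty]. *)
Lemma ge0_le_integralT d (T : measurableType d) (R : realType)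
    (mu : {measure set T -> \bar R}) (f g : T -> \bar R) :
  (forall x, 0 <= f x)%E -> (forall x, f x <= g x)%E ->
  (\int[mu]_x f x <= \int[mu]_x g x)%E.
Proof.
move=> f0 fg; rewrite !ge0_integralTE//; last first.
  by move=> x; exact: le_trans (fg x).
apply: le_ereal_sup => _ [h/= hf <-]; exists h => // x.
exact: le_trans (fg x).
Qed.

Section complex_integral.
Context d (T : measurableType d) (R : realType).
Implicit Types (mu : {measure set T -> \bar R}) (f g : T -> R[i]).

Definition cmeasurable f :=
  measurable_fun setT (fun x => complex.Re (f x)) /\
  measurable_fun setT (fun x => complex.Im (f x)).

(** At [lebesgue_rV n] this is convertible to [cintegral], and goals pass from one form to the other
    by conversion. A part with infinite integral counts as 0. *)
Definition cint mu f : R[i] :=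
  (\int[mu]_x complex.Re (f x)) +i* (\int[mu]_x complex.Im (f x)).

Definition cintegrable mu f :=
  cmeasurable f /\ (\int[mu]_x (normc (f x))%:E < +oo)%E.

Lemma cmeasurableM f g : cmeasurable f -> cmeasurable g ->
  cmeasurable (fun x => f x * g x).
Proof.
move=> [rf jf] [rg jg]; split.
  under eq_fun do rewrite Re_mulc.
  by apply: measurable_funB; apply: measurable_funM.
under eq_fun do rewrite Im_mulc.
by apply: measurable_funD; apply: measurable_funM.
Qed.

Lemma cmeasurable_real (h : T -> R) : measurable_fun setT h ->
  cmeasurable (fun x => (h x)%:C).
Proof. by move=> mh; split => //=; exact: measurable_cst. Qed.

Lemma cmeasurable_cst (c : R[i]) : cmeasurable (fun=> c).
Proof. by split; exact: measurable_cst. Qed.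

Lemma cmeasurable_conj f : cmeasurable f -> cmeasurable (fun x => conjc (f x)).
Proof.
move=> [rf jf]; split.
  by apply: eq_measurable_fun rf => x _; case: (f x).
by apply: eq_measurable_fun (measurable_funN jf) => x _ /=; case: (f x).
Qed.

Lemma cmeasurable_expi (h : T -> R) : measurable_fun setT h ->
  cmeasurable (fun x => expi (h x)).
Proof.
move=> mh; split => /=; apply: measurableT_comp => //.
  by apply: continuous_measurable_fun; exact: continuous_cos.
by apply: continuous_measurable_fun; exact: continuous_sin.
Qed.

Lemma measurable_normc f : cmeasurable f ->
  measurable_fun setT (fun x => normc (f x)).
Proof.
move=> [rf jf].
rewrite (_ : (fun _ => _) =
    Num.sqrt \o (fun x => complex.Re (f x) ^+ 2 + complex.Im (f x) ^+ 2)).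
  apply: measurableT_comp; first by apply: continuous_measurable_fun;
    exact: sqrt_continuous.
  by apply: measurable_funD; exact: measurable_funX.
by apply/funext => x/=; rewrite -sqr_normcE sqrtr_sqr ger0_norm// normc_ge0.
Qed.

Lemma measurable_normcE f : cmeasurable f ->
  measurable_fun setT (fun x => (normc (f x))%:E).
Proof. by move=> mf; apply/measurable_EFinP; exact: measurable_normc. Qed.

Lemma cintegrable_Re mu f : cintegrable mu f ->
  mu.-integrable setT (fun x => (complex.Re (f x))%:E).
Proof.
move=> [[mr mi] foo]; apply/integrableP; split; first exact/measurable_EFinP.
apply: le_lt_trans foo; apply: ge0_le_integralT => x; first exact: abse_ge0.
by rewrite lee_fin normr_Re_le.
Qed.

Lemma cintegrable_Im mu f : cintegrable mu f ->
  mu.-integrable setT (fun x => (complex.Im (f x))%:E).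
Proof.
move=> [[mr mi] foo]; apply/integrableP; split; first exact/measurable_EFinP.
apply: le_lt_trans foo; apply: ge0_le_integralT => x; first exact: abse_ge0.
by rewrite lee_fin normr_Im_le.
Qed.

Lemma cintegrable_le mu f (h : T -> \bar R) : cmeasurable f ->
  (forall x, (normc (f x))%:E <= h x)%E -> (\int[mu]_x h x < +oo)%E ->
  cintegrable mu f.
Proof.
move=> mf fh hoo; split => //; apply: le_lt_trans hoo.
by apply: ge0_le_integralT => // x; rewrite lee_fin normc_ge0.
Qed.

Lemma cintegrable_integrable mu f : cintegrable mu f ->
  mu.-integrable setT (fun x => (normc (f x))%:E).
Proof.
move=> [mf foo]; apply/integrableP; split; first exact: measurable_normcE.
by under eq_integral do rewrite gee0_abs ?lee_fin ?normc_ge0//.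
Qed.

Lemma cintegrableMb mu f g (K : R) : cmeasurable g ->
  (forall x, normc (g x) <= K) -> cintegrable mu f ->
  cintegrable mu (fun x => g x * f x).
Proof.
move=> mg gK [mf foo]; split; first exact: cmeasurableM.
(* The bound by K forces K >= 0 only if the space has a point. *)
have [//|/set0P[x0 _]] := eqVneq [set: T] set0.
  by move=> T0; rewrite T0 integral_set0.
have K0 : 0 <= K by apply: le_trans (gK x0); exact: normc_ge0.
apply: (@le_lt_trans _ _ (\int[mu]_x (K%:E * (normc (f x))%:E))%E).
  apply: ge0_le_integralT => x; first by rewrite lee_fin normc_ge0.
  by rewrite -EFinM lee_fin normcM ler_wpM2r// normc_ge0.
have mn := measurable_normcE mf.
rewrite ge0_integralZl_EFin//; last by move=> x _; rewrite lee_fin normc_ge0.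
by rewrite lte_mul_pinfty// ge0_fin_numE// integral_ge0// => x _;
  rewrite lee_fin normc_ge0.
Qed.

Lemma cintegrableZ mu f (c : R[i]) : cintegrable mu f ->
  cintegrable mu (fun x => c * f x).
Proof.
by apply: (@cintegrableMb _ _ (fun=> c) (normc c)) => //; exact: cmeasurable_cst.
Qed.

Lemma cint_ext mu f g : f =1 g -> cint mu f = cint mu g.
Proof. by move=> /funext ->. Qed.

Lemma cint_real mu (h : T -> R) : cint mu (fun x => (h x)%:C) = (\int[mu]_x h x)%:C.
Proof. by rewrite /cint/= [X in _ +i* X]/Rintegral integral0. Qed.

Lemma cintZ mu f (c : R[i]) : cintegrable mu f ->
  c * cint mu f = cint mu (fun x => c * f x).
Proof.
move=> fi; have ri := cintegrable_Re fi; have ii := cintegrable_Im fi.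
have Z (a : R) (h : T -> R) : mu.-integrable setT (EFin \o h) ->
    mu.-integrable setT (EFin \o (fun x => a * h x)).
  by move=> hi; exact: (integrableZl measurableT a hi).
rewrite /cint; case: c => a b; apply/eqP; rewrite eq_complex/=; apply/andP; split;
  apply/eqP.
  rewrite -!RintegralZl//= -RintegralB//; try exact: Z.
  by apply: eq_Rintegral => x _; case: (f x).
rewrite -!RintegralZl//= -RintegralD//; try exact: Z.
by apply: eq_Rintegral => x _; case: (f x).
Qed.

Lemma cintD mu f g : cintegrable mu f -> cintegrable mu g ->
  cint mu f + cint mu g = cint mu (fun x => f x + g x).
Proof.
move=> fi gi; rewrite /cint; apply/eqP; rewrite eq_complex/=; apply/andP; split;
  apply/eqP.
  rewrite -RintegralD//; try exact: cintegrable_Re.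
  by apply: eq_Rintegral => x _; case: (f x); case: (g x).
rewrite -RintegralD//; try exact: cintegrable_Im.
by apply: eq_Rintegral => x _; case: (f x); case: (g x).
Qed.

Lemma conjc_cint mu f : cintegrable mu f ->
  conjc (cint mu f) = cint mu (fun x => conjc (f x)).
Proof.
move=> fi; have ii := cintegrable_Im fi.
apply/eqP; rewrite eq_complex/=; apply/andP; split; apply/eqP.
  by apply: eq_Rintegral => x _; case: (f x).
rewrite -mulN1r -RintegralZl//.
by apply: eq_Rintegral => x _; rewrite mulN1r; case: (f x).
Qed.

Let normc_cint_le_integrable mu f : cintegrable mu f ->
  ((normc (cint mu f))%:E <= \int[mu]_x (normc (f x))%:E)%E.
Proof.
move=> fi; have ri := cintegrable_Re fi; have ii := cintegrable_Im fi.
have ni := cintegrable_integrable fi.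
have noo : (\int[mu]_x (normc (f x))%:E)%E \is a fin_num.
  by rewrite ge0_fin_numE; [case: fi|apply: integral_ge0 => x _;
    rewrite lee_fin normc_ge0].
set c := cint mu f.
have [c0|c0] := eqVneq (normc c) 0.
  by rewrite c0; apply: integral_ge0 => x _; rewrite lee_fin normc_ge0.
have cgt0 : 0 < normc c by rewrite lt_neqAle eq_sym c0 normc_ge0.
(* the real part of [conj c * f] is dominated by [|c| |f|] and integrates to [|c|^2] *)
have E : (normc c) ^+ 2 = complex.Re (cint mu (fun x => conjc c * f x)).
  by rewrite -cintZ// -/c mulrC mul_conjc.
rewrite -(fineK noo) lee_fin -(ler_pM2l cgt0) -expr2 E.
rewrite (_ : fine _ = \int[mu]_x normc (f x))// -RintegralZl//.
apply: le_Rintegral => //.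
- exact/cintegrable_Re/cintegrableZ.
- exact: (integrableZl measurableT _ ni).
- move=> x _; rewrite -(normc_conj c) -normcM.
  exact: le_trans (ler_norm _) (normr_Re_le _).
Qed.

(** An infinite right-hand side makes the bound trivial, so it can be applied to a pairing before
    its convergence is known. *)
Lemma normc_cint_le mu f : cmeasurable f ->
  ((normc (cint mu f))%:E <= \int[mu]_x (normc (f x))%:E)%E.
Proof.
move=> mf; have [foo|] := ltP (\int[mu]_x (normc (f x))%:E)%E +oo%E.
  exact: normc_cint_le_integrable.
by rewrite leye_eq => /eqP ->; exact: leey.
Qed.

End complex_integral.

(** * Fubini's theorem for complex integrands *)

Section complex_fubini.
Context d1 d2 (T1 : measurableType d1) (T2 : measurableType d2) (R : realType).
Variables (m1 : {sigma_finite_measure set T1 -> \bar R})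
  (m2 : {sigma_finite_measure set T2 -> \bar R}).
Implicit Types f : T1 * T2 -> R[i].

Lemma cmeasurable_comp d (T : measurableType d) (h : T -> T1) (f : T1 -> R[i]) :
  measurable_fun setT h -> cmeasurable f -> cmeasurable (fun x => f (h x)).
Proof.
move=> mh [mr mi].
by split; [exact: (measurableT_comp mr mh)|exact: (measurableT_comp mi mh)].
Qed.

(** Tonelli handles the positive and the negative part separately, and [fine] is measurable;
    sections with a divergent integral are thus included. Fourier transforms and Wigner
    distributions inherit measurability from their integrands. *)
Lemma measurable_Rintegral2 (h : T1 * T2 -> R) : measurable_fun setT h ->
  measurable_fun setT (fun x => \int[m2]_y h (x, y)).
Proof.
move=> mh; have mE : measurable_fun setT (EFin \o h) by exact/measurable_EFinP.
apply: (measurableT_comp (@fine_measurable R setT measurableT)).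
pose Fp x := (\int[m2]_y (EFin \o h)^\+ (x, y))%E.
pose Fn x := (\int[m2]_y (EFin \o h)^\- (x, y))%E.
have -> : (fun x => \int[m2]_y (h (x, y))%:E)%E = (Fp \- Fn)%E.
  apply/funext => x; rewrite [LHS]integralE.
  have -> : ((fun y => (h (x, y))%:E)^\+ = (EFin \o h)^\+ \o pair x)%E.
    exact: (funepos_comp (EFin \o h) (pair x)).
  have -> : ((fun y => (h (x, y))%:E)^\- = (EFin \o h)^\- \o pair x)%E.
    exact: (funeneg_comp (EFin \o h) (pair x)).
  by [].
apply: emeasurable_funB.
  by apply: measurable_fun_fubini_tonelli_F => //; exact: measurable_funepos.
by apply: measurable_fun_fubini_tonelli_F => //; exact: measurable_funeneg.
Qed.

Lemma cmeasurable_cint f : cmeasurable f ->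
  cmeasurable (fun x => cint m2 (fun y => f (x, y))).
Proof.
by move=> [mr mi]; split;
  [exact: (measurable_Rintegral2 mr)|exact: (measurable_Rintegral2 mi)].
Qed.

Lemma cintegrable_prod f : cmeasurable f ->
  (\int[m1]_x \int[m2]_y (normc (f (x, y)))%:E < +oo)%E ->
  cintegrable (m1 \x m2)%E f.
Proof.
move=> mf foo; split => //.
rewrite (fubini_tonelli1 (fun p => (normc (f p))%:E))//;
  first exact: measurable_normcE.
by move=> p; rewrite lee_fin normc_ge0.
Qed.

(** Where a section is not integrable the inner integral may be a default value; this happens only
    on a null set, which equality almost everywhere ignores. *)
Lemma Rintegral12_prod (h : T1 * T2 -> R) :
  (m1 \x m2)%E.-integrable setT (EFin \o h) ->
  \int[m1]_x \int[m2]_y h (x, y) = \int[(m1 \x m2)%E]_p h p.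
Proof.
move=> hi; have Fi := integrable_fubini_F hi.
rewrite /Rintegral -[in RHS](integral12_prod_meas1 hi); congr fine.
apply: ae_eq_integral => //.
- apply/measurable_EFinP; apply: (measurableT_comp (@fine_measurable R setT
    measurableT)).
  exact: measurable_int Fi.
- exact: measurable_int Fi.
- apply: filterS (ae_integrable1 hi) => x hx _; rewrite fineK//.
  exact: integrable_fin_num hx.
Qed.

Lemma cint_prod f : cintegrable (m1 \x m2)%E f ->
  cint m1 (fun x => cint m2 (fun y => f (x, y))) = cint (m1 \x m2)%E f.
Proof.
move=> fi; rewrite /cint /=; congr Complex.
  exact: (Rintegral12_prod (h := fun p => complex.Re (f p)) (cintegrable_Re fi)).
exact: (Rintegral12_prod (h := fun p => complex.Im (f p)) (cintegrable_Im fi)).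
Qed.

End complex_fubini.

Section complex_fubini_swap.
Context d1 d2 (T1 : measurableType d1) (T2 : measurableType d2) (R : realType).
Variables (m1 : {sigma_finite_measure set T1 -> \bar R})
  (m2 : {sigma_finite_measure set T2 -> \bar R}).

Lemma RFubini (h : T1 * T2 -> R) :
  (m1 \x m2)%E.-integrable setT (EFin \o h) ->
  \int[m1]_x \int[m2]_y h (x, y) = \int[m2]_y \int[m1]_x h (x, y).
Proof.
move=> hi; have mh : measurable_fun setT (EFin \o h) := measurable_int _ hi.
pose k (p : T2 * T1) := h (p.2, p.1).
have mk : measurable_fun setT (EFin \o k).
  exact: (measurableT_comp mh (measurable_fun_pair measurable_snd measurable_fst)).
have ki : (m2 \x m1)%E.-integrable setT (EFin \o k).
  by apply/(integrable12ltyP m2 m1 mk); exact: (integrable21ltyP m1 m2 mh).1 hi.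
rewrite Rintegral12_prod// -[RHS]/(\int[m2]_y \int[m1]_x k (y, x)) Rintegral12_prod//.
rewrite /Rintegral -(integral12_prod_meas1 hi) -(integral12_prod_meas1 ki).
by congr fine; exact: (Fubini hi).
Qed.

Lemma cint_fubini (f : T1 * T2 -> R[i]) : cmeasurable f ->
  (\int[m1]_x \int[m2]_y (normc (f (x, y)))%:E < +oo)%E ->
  cint m1 (fun x => cint m2 (fun y => f (x, y))) =
  cint m2 (fun y => cint m1 (fun x => f (x, y))).
Proof.
move=> mf foo; have fi := cintegrable_prod mf foo.
rewrite /cint /=; congr Complex.
  exact: (RFubini (h := fun p => complex.Re (f p)) (cintegrable_Re fi)).
exact: (RFubini (h := fun p => complex.Im (f p)) (cintegrable_Im fi)).
Qed.

End complex_fubini_swap.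

(** * Lebesgue measure on R^n *)

Section change_of_variables.
Context d d' (T : measurableType d) (T' : measurableType d') (R : realType).
Variables (m : {measure set T -> \bar R}) (m' : {measure set T' -> \bar R}).

(** Each change of variables is established on nonnegative functions only; decomposing the real and
    imaginary parts into positive and negative parts carries it over to complex integrals. *)
Lemma cint_transfer (phi : T -> T') (k : R) : 0 <= k ->
  measurable_fun setT phi ->
  (forall g : T' -> \bar R, measurable_fun setT g -> (forall x, 0 <= g x)%E ->
    \int[m]_x g (phi x) = k%:E * \int[m']_x g x)%E ->
  forall f : T' -> R[i], cintegrable m' f ->
  cintegrable m (fun x => f (phi x)) /\
  cint m (fun x => f (phi x)) = k%:C * cint m' f.
Proof.
move=> k0 mphi H f fi; have [[mr mi] foo] := fi; split.
  split; first by split; [exact: (measurableT_comp mr mphi)|exact: (measurableT_comp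
    mi mphi)].
  rewrite (H (fun x => (normc (f x))%:E)).
  - have : (\int[m']_x (normc (f x))%:E)%E \is a fin_num.
      by rewrite ge0_fin_numE// integral_ge0// => x _; rewrite lee_fin normc_ge0.
    by move=> /fineK <-; rewrite -EFinM ltry.
  - exact: measurable_normcE.
  - by move=> x; rewrite lee_fin normc_ge0.
have HR (h : T' -> R) : measurable_fun setT h -> m'.-integrable setT (EFin \o h) ->
    \int[m]_x h (phi x) = k * \int[m']_x h x.
  move=> mh hi; have mE : measurable_fun setT (EFin \o h) by exact/measurable_EFinP.
  rewrite /Rintegral [in LHS]integralE [in RHS]integralE.
  have pE : (\int[m]_x (fun x => (h (phi x))%:E)^\+ x = k%:E * \int[m']_x (EFin \o
    h)^\+ x)%E.
    rewrite -(H ((EFin \o h)^\+)%E); last 2 first.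
    - exact: measurable_funepos.
    - by move=> x; exact: funepos_ge0.
    by rewrite (funepos_comp (EFin \o h) phi).
  have nE : (\int[m]_x (fun x => (h (phi x))%:E)^\- x = k%:E * \int[m']_x (EFin \o
    h)^\- x)%E.
    rewrite -(H ((EFin \o h)^\-)%E); last 2 first.
    - exact: measurable_funeneg.
    - by move=> x; exact: funeneg_ge0.
    by rewrite (funeneg_comp (EFin \o h) phi).
  have pf : (\int[m']_x (EFin \o h)^\+ x)%E \is a fin_num by exact:
    integrable_pos_fin_num.
  have nf : (\int[m']_x (EFin \o h)^\- x)%E \is a fin_num by exact:
    integrable_neg_fin_num.
  by rewrite pE nE -(fineK pf) -(fineK nf)/= mulrBr.
rewrite /cint; apply/eqP; rewrite eq_complex/= !mul0r subr0 addr0; apply/andP; split;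
  apply/eqP.
  by apply: HR => //; exact: cintegrable_Re.
by apply: HR => //; exact: cintegrable_Im.
Qed.

End change_of_variables.

Section lebesgue_affine.
Context {R : realType}.
Local Notation leb := (@lebesgue_measure R).

Lemma measurable_affine (c a : R) :
  measurable_fun setT ((fun t => c * t + a) : measurableTypeR R -> measurableTypeR R).
Proof.
by apply: measurable_funD; [exact: mulrl_measurable|exact: measurable_cst].
Qed.

(** Uniqueness of Lebesgue measure: c times its image under t |-> c t + a gives each interval ]x, y]
    the length y - x. *)
Lemma ge0_integral_affine_gt0 (c a : R) (g : R -> \bar R) : 0 < c ->
  measurable_fun setT g -> (forall t, 0 <= g t)%E ->
  (\int[leb]_t g (c * t + a)%R = c^-1%:E * \int[leb]_t g t)%E.
Proof.
move=> c0 mg g0; pose phi : measurableTypeR R -> measurableTypeR R := fun t => c * t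
  + a.
have mphi : measurable_fun setT phi by exact: measurable_affine.
have c0' : 0 <= c^-1 by rewrite invr_ge0 ltW.
pose cn : {nonneg R} := NngNum (ltW c0).
have E A : measurable A -> leb A = (mscale cn (pushforward leb phi)) A.
  apply: lebesgue_measure_unique => _ [[x y]] _ <-.
  rewrite /= /mscale/= /pushforward.
  rewrite (_ : phi @^-1` _ = `](x - a) / c, (y - a) / c]%classic); last first.
    apply/seteqP; split => t /=; rewrite !in_itv/= /phi ltr_pdivrMr// ler_pdivlMr//
      => /andP[]; lra.
  rewrite /= !lebesgue_measure_itv/= !lte_fin.
  rewrite ltr_pM2r ?invr_gt0// ltrD2r; case: ifPn => _; last by rewrite mule0.
  by rewrite -EFinM; congr EFin; field; rewrite gt_eqF.
transitivity (\int[pushforward leb phi]_t g t)%E.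
  by rewrite ge0_integral_pushforward.
rewrite (eq_measure_integral (mscale cn (pushforward leb phi)) (m1 := leb));
  last first.
  by move=> A mA _; exact: E.
rewrite ge0_integral_mscale// muleA -EFinM mulVf ?mul1e// gt_eqF//.
Qed.

Lemma ge0_integral_opp (g : R -> \bar R) :
  measurable_fun setT g -> (forall t, 0 <= g t)%E ->
  (\int[leb]_t g (- t)%R = \int[leb]_t g t)%E.
Proof.
move=> mg g0.
have mN : measurable_fun setT (-%R : measurableTypeR R -> measurableTypeR R) by
  exact: oppr_measurable.
transitivity (\int[pushforward leb (-%R : measurableTypeR R -> measurableTypeR R)]_t
  g t)%E.
  by rewrite ge0_integral_pushforward.
by apply: eq_measure_integral => A mA _; exact: lebesgue_measureN.
Qed.

Lemma ge0_integral_affine (c a : R) (g : R -> \bar R) : c != 0 ->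
  measurable_fun setT g -> (forall t, 0 <= g t)%E ->
  (\int[leb]_t g (c * t + a)%R = `|c|^-1%:E * \int[leb]_t g t)%E.
Proof.
move=> c0 mg g0; have [cp|cn|c0'] := ltgtP c 0; last by rewrite c0' eqxx in c0.
  rewrite ltr0_norm// -(ge0_integral_affine_gt0 (c := - c) a) ?oppr_gt0//.
  rewrite -[RHS](ge0_integral_opp (g := fun t => g (- c * t + a)))//.
  - by apply: eq_integral => t _; rewrite mulrNN.
  - by apply: (measurableT_comp mg); exact: measurable_affine.
by rewrite gtr0_norm// ge0_integral_affine_gt0.
Qed.

End lebesgue_affine.

Section lebesgue_rV_integrals.
Context {R : realType}.
Local Notation leb := (@lebesgue_measure R).
Local Notation lebn := (@lebesgue_rV R).

Lemma measurable_coord n (i : 'I_n) :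
  measurable_fun setT (fun v : 'rV[R]_n => v ord0 i).
Proof. exact: (@measurable_rV_coord _ R). Qed.

Lemma measurable_coordP d (T : measurableType d) n (f : T -> 'rV[R]_n) :
  (forall i, measurable_fun setT (fun x => f x ord0 i)) <-> measurable_fun setT f.
Proof.
split=> [mf|mf i]; first by apply: measurable_fun_rV => i; exact: mf.
exact: (measurableT_comp (measurable_coord i) mf).
Qed.

Lemma measurable_rVD d (T : measurableType d) n (f g : T -> 'rV[R]_n) :
  measurable_fun setT f -> measurable_fun setT g ->
  measurable_fun setT (fun x => f x + g x).
Proof.
move=> /measurable_coordP mf /measurable_coordP mg; apply/measurable_coordP => i.
by under eq_fun do rewrite mxE; exact: measurable_funD.
Qed.

Lemma measurable_rVZ d (T : measurableType d) n (c : R) (f : T -> 'rV[R]_n) :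
  measurable_fun setT f -> measurable_fun setT (fun x => c *: f x).
Proof.
move=> /measurable_coordP mf; apply/measurable_coordP => i.
by under eq_fun do rewrite mxE; apply: measurable_funM => //; exact: measurable_cst.
Qed.

Lemma measurable_rVN d (T : measurableType d) n (f : T -> 'rV[R]_n) :
  measurable_fun setT f -> measurable_fun setT (fun x => - f x).
Proof.
move=> /measurable_coordP mf; apply/measurable_coordP => i.
by under eq_fun do rewrite mxE; exact: measurable_funN.
Qed.

Lemma measurable_lsubmx d (T : measurableType d) m n (f : T -> 'rV[R]_(m + n)) :
  measurable_fun setT f -> measurable_fun setT (fun x => lsubmx (f x)).
Proof.
move=> /measurable_coordP mf; apply/measurable_coordP => i.
by under eq_fun do rewrite mxE; exact: mf.
Qed.

Lemma measurable_rsubmx d (T : measurableType d) m n (f : T -> 'rV[R]_(m + n)) :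
  measurable_fun setT f -> measurable_fun setT (fun x => rsubmx (f x)).
Proof.
move=> /measurable_coordP mf; apply/measurable_coordP => i.
by under eq_fun do rewrite mxE; exact: mf.
Qed.

Lemma measurable_row_mx d (T : measurableType d) m n
    (f : T -> 'rV[R]_m) (g : T -> 'rV[R]_n) :
  measurable_fun setT f -> measurable_fun setT g ->
  measurable_fun setT (fun x => row_mx (f x) (g x)).
Proof.
move=> /measurable_coordP mf /measurable_coordP mg; apply/measurable_coordP => i.
have [j ->|j ->] := split_ordP i.
  by under eq_fun do rewrite row_mxEl; exact: mf.
by under eq_fun do rewrite row_mxEr; exact: mg.
Qed.

Lemma measurable_dot d (T : measurableType d) n (f g : T -> 'rV[R]_n) :
  measurable_fun setT f -> measurable_fun setT g ->
  measurable_fun setT (fun x => dot (f x) (g x)).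
Proof.
move=> /measurable_coordP mf /measurable_coordP mg; rewrite /dot.
by apply: measurable_sum => i; exact: measurable_funM.
Qed.

Lemma measurable_prodR d (T : measurableType d) n (f : 'I_n -> T -> R) :
  (forall i, measurable_fun setT (f i)) ->
  measurable_fun setT (fun x => \prod_i f i x).
Proof. by move=> mf; apply: measurable_prod => i _; exact: mf. Qed.

Lemma integral_rV0 (g : 'rV[R]_0 -> \bar R) :
  (\int[lebn 0]_x g x = g 0%R)%E.
Proof.
have mg : measurable_fun setT g.
  have -> : g = cst (g 0) by apply/funext => x; congr g; apply/rowP => -[].
  exact: measurable_cst.
by rewrite [LHS]integral_dirac// diracT mul1e.
Qed.

Lemma integral_rV_cons n (g : 'rV[R]_n.+1 -> \bar R) :
  measurable_fun setT g -> (forall x, 0 <= g x)%E ->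
  (\int[lebn n.+1]_x g x = \int[leb]_t \int[lebn n]_v g (rV_cons (t, v)))%E.
Proof.
move=> mg g0.
have mc := @measurable_rV_cons R n.
rewrite -(fubini_tonelli1 (fun p => g (rV_cons p)))//;
  last exact: (measurableT_comp mg mc).
transitivity (\int[pushforward (leb \x lebn n) (@rV_cons R n)]_x g x)%E.
  by apply: eq_measure_integral.
by rewrite ge0_integral_pushforward.
Qed.

Lemma rV_cons_affine n (c : R) (a : 'rV[R]_n.+1) (t : R) (v : 'rV[R]_n) :
  c *: rV_cons (t, v) + a =
  rV_cons (c * t + a ord0 ord0, c *: v + rsubmx (a : 'rV[R]_(1 + n))).
Proof.
apply/rowP => i; have [j ->|j ->] := split_ordP (i : 'I_(1 + n)).
  rewrite (_ : lshift n j = ord0); last by apply/val_inj; rewrite /= ord1.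
  by rewrite rV_cons0 mxE [X in X + _]mxE rV_cons0.
by rewrite rV_consS mxE [X in X + _]mxE rV_consS /= 2!mxE [X in _ = _ + X]mxE.
Qed.

(** Induction on n: the first coordinate is split off, and each coordinate contributes one factor
    1/|c|. *)
Lemma ge0_integral_rV_affine n (c : R) (a : 'rV[R]_n) (g : 'rV[R]_n -> \bar R) :
  c != 0 -> measurable_fun setT g -> (forall x, 0 <= g x)%E ->
  (\int[lebn n]_x g (c *: x + a)%R = ((`|c|^-1) ^+ n)%:E * \int[lebn n]_x g x)%E.
Proof.
move=> c0; elim: n a g => [|n IHn] a g mg g0.
  by rewrite !integral_rV0 expr0 mul1e; congr g; apply/rowP => -[].
have mc := @measurable_rV_cons R n.
have mga : measurable_fun setT (fun x : 'rV[R]_n.+1 => g (c *: x + a)).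
  by apply: (measurableT_comp mg); apply: measurable_rVD;
    [exact: measurable_rVZ|exact: measurable_cst].
have mgc : measurable_fun setT (fun p => g (rV_cons p)) by exact: (measurableT_comp
  mg mc).
rewrite !integral_rV_cons//.
pose a' := rsubmx (a : 'rV[R]_(1 + n)).
pose h (t : R) : \bar R := (\int[lebn n]_v g (rV_cons (t, v)))%E.
have h0 t : (0 <= h t)%E by apply: integral_ge0 => v _; exact: g0.
have mh : measurable_fun setT h.
  by apply: (measurable_fun_fubini_tonelli_F (fun p => g (rV_cons p))).
transitivity (\int[leb]_t (((`|c|^-1) ^+ n)%:E * h (c * t + a ord0 ord0)%R))%E.
  apply: eq_integral => t _; under eq_integral do rewrite rV_cons_affine.
  rewrite (IHn a' (fun v => g (rV_cons (c * t + a ord0 ord0, v))))//.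
  exact: (measurableT_comp mgc (pair1_measurable _)).
have mhc : measurable_fun setT (fun t => h (c * t + a ord0 ord0)).
  by apply: (measurableT_comp mh); exact: measurable_affine.
have k0 : 0 <= `|c|^-1 ^+ n by rewrite exprn_ge0// invr_ge0.
transitivity ((`|c|^-1 ^+ n)%:E * \int[leb]_t h (c * t + a ord0 ord0)%R)%E.
  by apply: ge0_integralZl_EFin => // t _; exact: h0.
by rewrite (ge0_integral_affine _ c0 mh h0) muleA -EFinM -exprSr.
Qed.

Lemma rV_cons_row_mx m n t (x : 'rV[R]_m) (y : 'rV[R]_n) :
  rV_cons (t, row_mx x y) = row_mx (rV_cons (t, x)) y :> 'rV[R]_(m.+1 + n).
Proof.
apply/rowP => i; have [j ->|j ->] := split_ordP i.
  rewrite row_mxEl; have [k ->|k ->] := split_ordP (j : 'I_(1 + m)).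
    rewrite (_ : @lshift m.+1 n _ = ord0 :> 'I_(m + n).+1); last by apply/val_inj;
      rewrite /= ord1.
    rewrite (_ : @lshift 1 m k = ord0 :> 'I_m.+1); last by apply/val_inj;
      rewrite /= ord1.
    by rewrite !rV_cons0.
  rewrite (_ : @lshift m.+1 n _ = @rshift 1 (m + n) (lshift n k) :> 'I_(1 + (m +
    n))); last exact/val_inj.
  by rewrite !rV_consS/= row_mxEl.
rewrite [RHS]row_mxEr (_ : @rshift m.+1 n j = @rshift 1 (m + n) (rshift m j) :> 'I_(1
  + (m + n))); last exact/val_inj.
by rewrite rV_consS /= row_mxEr.
Qed.

(** Tonelli for two blocks of coordinates. The measure is built one coordinate at a time, hence the
    induction on m, in which [rV_cons_row_mx] reassociates the blocks. *)
Lemma integral_row_mx m n (g : 'rV[R]_(m + n) -> \bar R) :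
  measurable_fun setT g -> (forall x, 0 <= g x)%E ->
  (\int[lebn (m + n)]_z g z = \int[lebn m]_x \int[lebn n]_y g (row_mx x y))%E.
Proof.
elim: m n g => [|m IHm] n g mg g0.
  rewrite integral_rV0; apply: eq_integral => y _; congr g.
  apply/rowP => i; rewrite -[X in _ = row_mx _ _ _ X](_ : rshift 0 i = i);
    last exact/val_inj.
  by rewrite row_mxEr.
have mc := @measurable_rV_cons R (m + n).
have mrow k : measurable_fun setT (fun p : 'rV[R]_k * 'rV[R]_n => row_mx p.1 p.2).
  by apply: measurable_row_mx.
rewrite [LHS](integral_rV_cons mg g0) integral_rV_cons; last 2 first.
- by apply: (measurable_fun_fubini_tonelli_F (fun p => g (row_mx p.1 p.2))) => //;
    exact: (measurableT_comp mg (mrow _)).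
- by move=> x; exact: integral_ge0.
apply: eq_integral => t _.
have mgt : measurable_fun setT (fun z => g (rV_cons (t, z))).
  exact: (measurableT_comp (measurableT_comp mg mc) (pair1_measurable _)).
rewrite (IHm _ _ mgt (fun=> g0 _)).
by apply: eq_integral => x _; apply: eq_integral => y _; rewrite rV_cons_row_mx.
Qed.

(** J^-1 (x, y) = (- y, x) exchanges the blocks, which Tonelli allows, up to affine maps of ratio -1
    and 1 inside each block. The translation by a serves the shift by x in [Theta_sigmaE]. *)
Lemma ge0_integral_symplectic n (a : 'rV[R]_(n + n)) (g : 'rV[R]_(n + n) -> \bar R) :
  measurable_fun setT g -> (forall x, 0 <= g x)%E ->
  (\int[lebn (n + n)]_z g (a + symplectic_inv z)%R = \int[lebn (n + n)]_z g z)%E.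
Proof.
move=> mg g0.
have mg2 d (T : measurableType d) (u v : T -> 'rV[R]_n) :
    measurable_fun setT u -> measurable_fun setT v ->
    measurable_fun setT (fun p => g (row_mx (u p) (v p))).
  by move=> mu mv; exact: (measurableT_comp mg (measurable_row_mx mu mv)).
have mga : measurable_fun setT (fun z : 'rV[R]_(n + n) => g (a + symplectic_inv z)).
  apply: (measurableT_comp mg); apply: measurable_rVD; first exact: measurable_cst.
  apply: measurable_row_mx; first exact/measurable_rVN/measurable_rsubmx.
  exact/measurable_lsubmx.
rewrite (integral_row_mx mga (fun=> g0 _)) (integral_row_mx mg g0).
have N10 : -1 != 0 :> R by rewrite oppr_eq0 oner_eq0.
have O10 : 1 != 0 :> R by exact: oner_neq0.
set a1 := lsubmx a; set a2 := rsubmx a.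
have E x y : a + symplectic_inv (row_mx x y) = row_mx (-1 *: y + a1) (1 *: x + a2).
  by rewrite /symplectic_inv row_mxKl row_mxKr -[in LHS](hsubmxK a) add_row_mx
    scaleN1r scale1r addrC (addrC x).
transitivity (\int[lebn n]_x \int[lebn n]_y g (row_mx y (1 *: x + a2)))%E.
  apply: eq_integral => x _; under eq_integral do rewrite E.
  rewrite (ge0_integral_rV_affine _ N10 (g := fun y => g (row_mx y (1 *: x + a2))))//.
  - by rewrite normrN1 invr1 expr1n mul1e.
  - by apply: mg2 => //; exact: measurable_cst.
have ms : measurable_fun setT (fun p : 'rV[R]_n * 'rV[R]_n => g (row_mx p.2 (1 *: p.1
  + a2))).
  apply: mg2 => //; apply: measurable_rVD;
    [exact: measurable_rVZ|exact: measurable_cst].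
rewrite (fubini_tonelli (fun p : 'rV[R]_n * 'rV[R]_n => g (row_mx p.2 (1 *: p.1 +
  a2))) ms (fun=> g0 _)).
apply: eq_integral => y _.
rewrite (ge0_integral_rV_affine _ O10 (g := fun x : 'rV[R]_n => g (row_mx y x)))//.
- by rewrite normr1 invr1 expr1n mul1e.
- by apply: mg2 => //; exact: measurable_cst.
Qed.

End lebesgue_rV_integrals.

(** * Integrals of tensor products *)

Section tensor.
Context {R : realType}.
Local Notation leb := (@lebesgue_measure R).
Local Notation lebn := (@lebesgue_rV R).

Lemma cmeasurable_prod d (T : measurableType d) n (h : 'I_n -> T -> R[i]) :
  (forall i, cmeasurable (h i)) -> cmeasurable (fun x => \prod_i h i x).
Proof.
elim: n h => [|n IHn] h mh.
  by under [X in cmeasurable X]eq_fun do rewrite big_ord0; exact: cmeasurable_cst.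
under [X in cmeasurable X]eq_fun do rewrite big_ord_recl.
by apply: cmeasurableM => //; apply: (IHn (fun i => h (lift ord0 i))) => i.
Qed.

Lemma prod_rV_cons (S : comPzRingType) n (g : 'I_n.+1 -> R -> S) (t : R) (v :
  'rV[R]_n) :
  \prod_i g i (rV_cons (t, v) ord0 i) =
  g ord0 t * \prod_i g (lift ord0 i) (v ord0 i).
Proof.
rewrite big_ord_recl rV_cons0; congr (_ * _); apply: eq_bigr => i _.
by rewrite (_ : lift ord0 i = rshift 1 i) ?rV_consS//; exact/val_inj.
Qed.

Lemma ge0_integral_tensor n (g : 'I_n -> R -> R) (c : 'I_n -> R) :
  (forall i, measurable_fun setT (g i)) -> (forall i t, 0 <= g i t) ->
  (forall i, \int[leb]_t (g i t)%:E = (c i)%:E)%E ->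
  (\int[lebn n]_x (\prod_i g i (x ord0 i))%:E = (\prod_i c i)%:E)%E.
Proof.
elim: n g c => [|n IHn] g c mg g0 gc.
  by rewrite integral_rV0 !big_ord0.
pose G (x : 'rV[R]_n.+1) : \bar R := (\prod_i g i (x ord0 i))%:E.
have mG : measurable_fun setT G.
  by apply/measurable_EFinP/measurable_prodR => i;
    exact: (measurableT_comp (mg i) (measurable_coord i)).
have G0 x : (0 <= G x)%E by rewrite lee_fin prodr_ge0.
rewrite -/(\int[lebn n.+1]_x G x)%E (integral_rV_cons mG G0).
have c0 i : 0 <= c i by rewrite -lee_fin -gc integral_ge0// => t _; rewrite lee_fin.
transitivity (\int[leb]_t ((\prod_i c (lift ord0 i))%:E * (g ord0 t)%:E))%E.
  apply: eq_integral => t _.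
  rewrite -(IHn (fun i => g (lift ord0 i)))// muleC.
  under eq_integral do rewrite /G prod_rV_cons EFinM.
  apply: ge0_integralZl_EFin => //.
  - by move=> v _; rewrite lee_fin prodr_ge0.
  - by apply/measurable_EFinP/measurable_prodR => i;
      exact: (measurableT_comp (mg _) (measurable_coord i)).
transitivity ((\prod_i c (lift ord0 i))%:E * \int[leb]_t (g ord0 t)%:E)%E.
  apply: ge0_integralZl_EFin => //.
  - by move=> t _; rewrite lee_fin.
  - by apply/measurable_EFinP; exact: mg.
  - exact: prodr_ge0.
by rewrite gc -EFinM mulrC big_ord_recl.
Qed.

Lemma cintegrable_tensor n (h : 'I_n -> R -> R[i]) :
  (forall i, cintegrable leb (h i)) ->
  cintegrable (lebn n) (fun x => \prod_i h i (x ord0 i)).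
Proof.
move=> hi; split.
  apply: cmeasurable_prod => i; apply: (cmeasurable_comp (measurable_coord i)).
  by case: (hi i).
pose c i := fine (\int[leb]_t (normc (h i t))%:E)%E.
under eq_integral do rewrite normc_prod.
rewrite (ge0_integral_tensor (g := fun i t => normc (h i t)) (c := c)) ?ltry//.
- by move=> i; apply: measurable_normc; case: (hi i).
- by move=> i t; exact: normc_ge0.
- move=> i; rewrite fineK// ge0_fin_numE; first by case: (hi i).
  by apply: integral_ge0 => t _; rewrite lee_fin normc_ge0.
Qed.

Lemma cint_rV0 (f : 'rV[R]_0 -> R[i]) : cint (lebn 0) f = f 0.
Proof.
rewrite /cint /Rintegral; have E (h : 'rV[R]_0 -> R) : (\int[lebn 0]_x (h x)%:E = (h
  0%R)%:E)%E.
  exact: (integral_rV0 (fun x => (h x)%:E)).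
by rewrite !E/=; case: (f 0).
Qed.

(** Transfer along [rV_cons] turns the integral into one for the product measure, where complex
    Fubini separates the first factor from the others. *)
Lemma cint_tensor n (h : 'I_n -> R -> R[i]) :
  (forall i, cintegrable leb (h i)) ->
  cint (lebn n) (fun x => \prod_i h i (x ord0 i)) = \prod_i cint leb (h i).
Proof.
elim: n h => [|n IHn] h hi; first by rewrite cint_rV0 !big_ord0.
pose f (x : 'rV[R]_n.+1) := \prod_i h i (x ord0 i).
have fi : cintegrable (lebn n.+1) f by exact: cintegrable_tensor.
have T (g : 'rV[R]_n.+1 -> \bar R) : measurable_fun setT g -> (forall x, 0 <= g x)%E
  ->
    (\int[leb \x lebn n]_p g (rV_cons p) = 1%:E * \int[lebn n.+1]_x g x)%E.
  move=> mg g0; rewrite mul1e integral_rV_cons// (fubini_tonelli1 (fun p => g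
    (rV_cons p)))//.
  exact: (measurableT_comp mg (@measurable_rV_cons R n)).
have [fci fcE] := cint_transfer ler01 (@measurable_rV_cons R n) T fi.
rewrite -/(cint (lebn n.+1) f) -[LHS]mul1r -[1]/(1%:C) -fcE -(cint_prod fci)
  big_ord_recl.
have hi' i : cintegrable leb (h (lift ord0 i)) by [].
rewrite -(IHn (fun i => h (lift ord0 i)))// mulrC cintZ//.
apply: cint_ext => t; rewrite mulrC cintZ; last exact: (cintegrable_tensor hi').
by apply: cint_ext => v; rewrite /f prod_rV_cons.
Qed.

End tensor.

(** * A bump function and its Fourier transform *)

Section bump.
Context {R : realType}.
Implicit Types (p : {poly R}) (k : nat) (t : R).

(* Multiples of [exp (- 1 / (1 - t^2))] by [p / (1 - t^2)^k]: a family of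
   functions that is stable by derivation. *)
Definition bump_fun (q : {poly R} * nat) t : R :=
  if `|t| < 1 then q.1.[t] * (1 - t ^+ 2)^-1 ^+ q.2 * expR (- (1 - t ^+ 2)^-1)
  else 0.

(** The derivative of p u^-k exp (- 1 / u) for u = 1 - t^2, u' = - 2 t, over the common denominator
    u^(k + 2). *)
Definition bump_step (q : {poly R} * nat) : {poly R} * nat :=
  let u := 1 - 'X^2 in
  (q.1^`() * u ^+ 2 + (2 * q.2%:R) *: ('X * q.1 * u) - 2 *: ('X * q.1), q.2.+2).

Lemma bump_out q t : 1 <= `|t| -> bump_fun q t = 0.
Proof. by rewrite /bump_fun leNgt => /negbTE ->. Qed.

Lemma onemsqr_gt0 t : `|t| < 1 -> 0 < 1 - t ^+ 2.
Proof.
by move=> t1; rewrite subr_gt0 -real_normK ?num_real// expr_lt1.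
Qed.

Lemma poly_bound p : exists2 C, 0 <= C & forall t, `|t| < 1 -> `|p.[t]| <= C.
Proof.
exists (\sum_(i < size p) `|p`_i|); first exact: sumr_ge0.
move=> t t1; rewrite horner_coef; apply: le_trans (ler_norm_sum _ _ _) _.
apply: ler_sum => i _; rewrite normrM normrX ler_piMr// exprn_ile1//.
exact: ltW.
Qed.

(** The exponential series contains the term u^(m + 1) / (m + 1)!. *)
Lemma exprn_expRN_le m (u : R) : 0 <= u -> u ^+ m.+1 * expR (- u) <= m.+1`!%:R.
Proof.
move=> u0; have m0 : 0 < m.+1`!%:R :> R by rewrite ltr0n fact_gt0.
rewrite expRN ler_pdivrMr ?expR_gt0// mulrC -ler_pdivrMr//.
by apply: le_trans (expR_ge1Dxn m u0); rewrite lerDr.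
Qed.

(** The factor exp (- 1 / u) beats u^-(k + 2) as well as u^-k, which leaves two spare powers of u =
    1 - t^2. They make the derivative vanish at the endpoints in [is_derive_bump]. *)
Lemma bump_bound q : exists2 C, 0 <= C &
  forall t, `|bump_fun q t| <= C * (1 - t ^+ 2) ^+ 2 /\ `|bump_fun q t| <= C.
Proof.
case: q => p k; have [P P0 pP] := poly_bound p.
pose C := P * k.+2`!%:R; have C0 : 0 <= C by rewrite mulr_ge0.
exists C => // t; have [t1|t1] := ltP `|t| 1; last first.
  by rewrite bump_out// normr0 C0 mulr_ge0// sqr_ge0.
have u0 := onemsqr_gt0 t1.
suff H : `|bump_fun (p, k) t| <= C * (1 - t ^+ 2) ^+ 2.
  split => //; apply: le_trans H _; rewrite ler_piMr// exprn_ile1 ?(ltW u0)//.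
  by rewrite gerBl sqr_ge0.
rewrite /bump_fun t1/= !normrM normrX (gtr0_norm (expR_gt0 _)).
rewrite (gtr0_norm (_ : 0 < (1 - t ^+ 2)^-1)) ?invr_gt0//.
set u := 1 - t ^+ 2 in u0 *.
have -> : u^-1 ^+ k = u^-1 ^+ k.+2 * u ^+ 2.
  by rewrite -(addn2 k) exprD -mulrA -exprMn mulVf ?gt_eqF// expr1n mulr1.
rewrite -mulrA mulrAC mulrA ler_wpM2r ?sqr_ge0// /C ler_pM ?normr_ge0 ?pP//.
  by rewrite mulr_ge0 ?expR_ge0// exprn_ge0// invr_ge0 ltW.
by apply: exprn_expRN_le; rewrite invr_ge0 ltW.
Qed.

Lemma is_derive_bump_in q t : `|t| < 1 ->
  is_derive t 1 (bump_fun q) (bump_fun (bump_step q) t).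
Proof.
case: q => p k t1; have u0 := onemsqr_gt0 t1.
have un0 : 1 - t ^+ 2 != 0 by rewrite gt_eqF.
pose u (x : R) := 1 - x ^+ 2.
have du : is_derive t 1 u (- (2 * t)).
  by rewrite /u; apply: is_derive_eq; rewrite /GRing.scale/=; ring.
have dv : is_derive t 1 (fun x => (u x)^-1) (2 * t * (u t)^-1 ^+ 2).
  apply: (is_derive_eq (is_deriveV (f := u) un0 du)).
  by rewrite /GRing.scale/= mulNr mulrN opprK exprVn mulrC.
have dw : is_derive t 1 (fun x => (u x)^-1 ^+ k)
    (k%:R * (u t)^-1 ^+ k.+1 * (2 * t)).
  have -> : (fun x => (u x)^-1 ^+ k) = (fun x => (u x)^-1) ^+ k by rewrite fctE.
  apply: (is_derive_eq (is_deriveX k dv)).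
  rewrite /GRing.scale/=.
  by case: k => [|k]; [rewrite !mul0r|rewrite /= !exprS; ring].
have de : is_derive t 1 (expR \o (fun x => - (u x)^-1)) (expR (- (u t)^-1) * - (2 * t
  * (u t)^-1 ^+ 2)).
  exact: is_derive1_comp.
have dp : is_derive t 1 (horner p) p^`().[t] by exact: is_derive_poly.
apply: (near_eq_is_derive (f := (horner p * (fun x => (u x)^-1 ^+ k)) * (expR \o (fun
  x => - (u x)^-1)))).
  have : \forall x \near t, `|x| < 1.
    exact: (@cvgr_norm_lt R R R (nbhs t) _ id t cvg_id 1 t1).
  by apply: filterS => x x1; rewrite /bump_fun x1.
apply: (is_derive_eq (is_deriveM (is_deriveM dp dw) de)).
have un : u t != 0 by [].
rewrite /bump_fun t1 (_ : (bump_step (p, k)).2 = k.+2)// -/(u t) !exprS !fctE.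
rewrite /GRing.scale; move: (expR _) ((u t)^-1 ^+ k) => E V.
by rewrite /bump_step /= !hornerE /= -/(u t); field.
Qed.

Lemma is_derive_bump q t : is_derive t 1 (bump_fun q) (bump_fun (bump_step q) t).
Proof.
have [t1|t1] := ltP `|t| 1; first exact: is_derive_bump_in.
rewrite (bump_out _ t1); move: t1; rewrite le_eqVlt => /predU1P[t1|t1]; last first.
  apply: (near_eq_is_derive (f := cst 0)).

  have : \forall x \near t, 1 < `|x|.
    exact: (@cvgr_norm_gt R R R (nbhs t) _ id t cvg_id 1 t1).
  by apply: filterS => x x1; rewrite bump_out// ltW.
(* at the endpoints the function is O((1 - t^2)^2), hence O((z - t)^2) *)
have [C C0 qC] := bump_bound q.
have tt : t ^+ 2 = 1 by rewrite -real_normK ?num_real// -t1 expr1n.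
apply/is_derive1_caratheodory; exists (fun z => bump_fun q z / (z - t)).
have ft0 : bump_fun q t = 0 by rewrite bump_out// -t1.
have fq z : `|bump_fun q z| <= (4 * C) * `|z - t| ^+ 2.
  have [z1|z1] := ltP `|z| 1; last first.
    by rewrite bump_out// normr0 mulr_ge0// ?mulr_ge0// sqr_ge0.
  apply: le_trans (qC z).1 _; rewrite -tt (_ : t ^+ 2 - z ^+ 2 = (z - t) * - (z +
    t)); last by ring.
  rewrite exprMn sqrrN real_normK ?num_real// mulrCA mulrC ler_wpM2r ?sqr_ge0//.
  rewrite mulrC ler_wpM2r// -real_normK ?num_real//.
  have : `|z + t| <= 2 by apply: le_trans (ler_normD _ _) _; rewrite -t1; lra.
  by have := normr_ge0 (z + t); nra.
split.
- move=> z; rewrite ft0 subr0; have [->|zt] := eqVneq z t.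
    by rewrite ft0 mul0r subrr mulr0.
  by rewrite divfK// subr_eq0.
- apply/cvgrPdist_le => e e0; rewrite ft0 mul0r.
  near=> z; rewrite sub0r normrN normrM normfV.
  have [->|zt] := eqVneq z t; first by rewrite ft0 normr0 mul0r ltW.
  have zt0 : 0 < `|z - t| by rewrite normr_gt0 subr_eq0.
  rewrite ler_pdivrMr//; apply: le_trans (fq z) _.
  rewrite expr2 mulrA ler_wpM2r ?normr_ge0//.
  have : `|t - z| <= e / (4 * C + 1).
    near: z; apply: (@cvgr_dist_le _ R^o _ _ _ id t) => //.
    by rewrite divr_gt0//; lra.
  by rewrite distrC ler_pdivlMr; [nra|lra].
- by rewrite ft0 mul0r.
Unshelve. all: by end_near. Qed.

End bump.

(** * Integration by parts and decay of the Fourier transform of the bump *)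

Section bump_fourier.
Context {R : realType}.
Local Notation leb := (@lebesgue_measure R).

(* The factor [expR 1] normalises [bump 0] to 1. *)
Definition bump_seq (k : nat) : {poly R} * nat :=
  iter k bump_step ((expR 1)%:P, 0%N).

Definition bumpD (k : nat) : R -> R := bump_fun (bump_seq k).

Definition bump : R -> R := bumpD 0.

Lemma is_derive_bumpD k (t : R) : is_derive t 1 (bumpD k) (bumpD k.+1 t).
Proof. exact: is_derive_bump. Qed.

Lemma bumpD_out k (t : R) : 1 <= `|t| -> bumpD k t = 0.
Proof. exact: bump_out. Qed.

Lemma bumpD_bound k : exists2 C, 0 <= C & forall t, `|bumpD k t| <= C.
Proof.
have [C C0 H] := bump_bound (bump_seq k).
by exists C => [//|t]; exact: (H t).2.
Qed.

Lemma continuous_bumpD k : continuous (bumpD k).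
Proof.
move=> t; apply/differentiable_continuous/derivable1_diffP.
by case: (is_derive_bumpD k t).
Qed.

Lemma measurable_bumpD k : measurable_fun setT (bumpD k).
Proof. by apply: continuous_measurable_fun; exact: continuous_bumpD. Qed.

Lemma bumpE (t : R) : `|t| < 1 -> bump t = expR (1 - (1 - t ^+ 2)^-1).
Proof. by move=> t1; rewrite /bump/bumpD/bump_fun t1 /= hornerE expr0 mulr1 expRD.
  Qed.

Lemma bump0 : bump 0 = 1.
Proof. by rewrite bumpE ?normr0// expr0n/= subr0 invr1 subrr expR0. Qed.

Lemma bump_gt0 (t : R) : `|t| < 1 -> 0 < bump t.
Proof. by move=> t1; rewrite bumpE// expR_gt0. Qed.

Lemma bump_ge0 (t : R) : 0 <= bump t.
Proof.
have [t1|t1] := ltP `|t| 1; first by rewrite ltW// bump_gt0.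
by rewrite /bump bumpD_out.
Qed.

Lemma bump_le1 (t : R) : bump t <= 1.
Proof.
have [t1|t1] := ltP `|t| 1; last by rewrite /bump bumpD_out.
rewrite bumpE// -[leRHS]expR0 ler_expR subr_le0 invf_ge1 ?onemsqr_gt0//.
by rewrite gerBl sqr_ge0.
Qed.

Lemma integrable_supp (f : R -> R) (C : R) : measurable_fun setT f ->
  (forall t, `|f t| <= C) -> (forall t, 1 <= `|t| -> f t = 0) ->
  leb.-integrable setT (EFin \o f) /\ `|\int[leb]_t f t| <= C * 2.
Proof.
move=> mf fC f1.
have C0 : 0 <= C by apply: le_trans (fC 0); exact: normr_ge0.
have fE t : `|f t| <= C * \1_(`[-1, 1] : set R) t.
  have [t1|t1] := leP `|t| 1.
    by rewrite indicE mem_set ?mulr1//= in_itv/= -ler_norml.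
  by rewrite (f1 _ (ltW t1)) normr0 mulr_ge0.
have iE : (\int[leb]_t (C * \1_(`[-1, 1] : set R) t)%:E = (C * 2)%:E)%E.
  under eq_integral do rewrite EFinM.
  rewrite ge0_integralZl_EFin//; last by apply/measurable_EFinP.
  rewrite integral_indic// setIT EFinM; congr (_ * _)%E.
  apply: etrans (lebesgue_measure_itv _) _; rewrite /= lte_fin ifT; last by lra.
  by rewrite -EFinD; congr EFin; lra.
have fi : leb.-integrable setT (EFin \o f).
  apply/integrableP; split; first exact/measurable_EFinP.
  apply: (@le_lt_trans _ _ (C * 2)%:E); last exact: ltry.
  by rewrite -iE; apply: ge0_le_integralT => t; rewrite ?abse_ge0//= lee_fin.
split => //; rewrite -lee_fin EFin_normr_Rintegral//.
apply: le_trans (le_abse_integral _ _ _) _ => //; first exact: measurable_int fi.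
by rewrite -iE; apply: ge0_le_integralT => t; rewrite ?abse_ge0//= lee_fin.
Qed.

(** The integral reduces to [-1, 1], where the fundamental theorem of calculus gives F 1 - F (-1) =
    0. *)
Lemma Rintegral_derive_supp (F f : R -> R) :
  (forall t : R, is_derive t 1 F (f t)) -> continuous f ->
  (forall t, 1 <= `|t| -> F t = 0) -> (forall t, 1 <= `|t| -> f t = 0) ->
  \int[leb]_t f t = 0.
Proof.
move=> dF cf F0 f0.
have cF : continuous F.
  move=> t; apply/differentiable_continuous/derivable1_diffP.
  by case: (dF t).
have -> : \int[leb]_t f t = \int[leb]_(t in `[-1, 1]) f t.
  rewrite [RHS]Rintegral_mkcond; apply: eq_Rintegral => t _; rewrite patchE.
  case: ifPn => //; rewrite notin_setE/= in_itv/= => /negP;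
    rewrite -ler_norml -ltNge => /ltW.
  exact: f0.
rewrite /Rintegral (@continuous_FTC2 _ f F)//.
- by rewrite !F0 ?normrN ?normr1//= subrr.
- exact: continuous_subspaceT.
- split.
  + by move=> t _; case: (dF t).
  + exact/cvg_at_right_filter/cF.
  + exact/cvg_at_left_filter/cF.
- by move=> t _; rewrite derive1E; case: (dF t).
Qed.

(** With [bsin], the real and imaginary parts, up to sign, of the Fourier transform of the k-th
    derivative; integration by parts then stays among real functions. *)
Definition bcos k s := \int[leb]_t (cos (2 * pi * s * t) * bumpD k t).
Definition bsin k s := \int[leb]_t (sin (2 * pi * s * t) * bumpD k t).

Lemma measurable_cosZ (c : R) : measurable_fun setT (fun t => cos (c * t)).
Proof.
apply: (measurableT_comp (continuous_measurable_fun (@continuous_cos R))).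
exact: mulrl_measurable.
Qed.

Lemma measurable_sinZ (c : R) : measurable_fun setT (fun t => sin (c * t)).
Proof.
apply: (measurableT_comp (continuous_measurable_fun (@continuous_sin R))).
exact: mulrl_measurable.
Qed.

Lemma trig_bump k (E : R -> R) : measurable_fun setT E -> (forall t, `|E t| <= 1) ->
  leb.-integrable setT (EFin \o (fun t => E t * bumpD k t)) /\
  forall C, (forall t, `|bumpD k t| <= C) -> `|\int[leb]_t (E t * bumpD k t)| <= C *
    2.
Proof.
move=> mE E1; have H C : (forall t, `|bumpD k t| <= C) ->
   leb.-integrable setT (EFin \o (fun t => E t * bumpD k t)) /\
   `|\int[leb]_t (E t * bumpD k t)| <= C * 2.
  move=> kC; apply: integrable_supp.
  - by apply: measurable_funM => //; exact: measurable_bumpD.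
  - move=> t; rewrite normrM; apply: le_trans (kC t).
    by rewrite ler_piMl.
  - by move=> t t1; rewrite bumpD_out// mulr0.
have [C _ /H[]] := bumpD_bound k.
by split => // C' /H[].
Qed.

(** Integration by parts: the derivative of the compactly supported product cos (c t) [bumpD k t]
    has integral 0. *)
Lemma bcosS k s : bcos k.+1 s = 2 * pi * s * bsin k s.
Proof.
set c := 2 * pi * s.
have [ic _] := trig_bump k.+1 (measurable_cosZ c) (fun t => cos_max _).
have [is_ _] := trig_bump k (measurable_sinZ c) (fun t => sin_max _).
apply/eqP; rewrite -subr_eq0; apply/eqP.
rewrite /bcos /bsin -/c -RintegralZl// -RintegralB//;
  last exact: (integrableZl measurableT _ is_).
apply: (Rintegral_derive_supp (F := fun t => cos (c * t) * bumpD k t)).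
- move=> t; have dc : is_derive t 1 (cos \o ( *%R c)) (- sin (c * t) * c).
    apply: is_derive1_comp; apply: (is_derive_eq (is_deriveZ c (is_derive_id t 1))).
    by rewrite /GRing.scale/= mulr1.
  apply: (is_derive_eq (is_deriveM dc (is_derive_bumpD k t))).
  by rewrite /GRing.scale/=; ring.
- move=> t; apply: cvgB; apply: cvgM.
  + by apply: continuous_comp; [apply: mulrl_continuous|exact: continuous_cos].
  + exact: continuous_bumpD.
  + exact: cvg_cst.
  + apply: cvgM; last exact: continuous_bumpD.
    by apply: continuous_comp; [apply: mulrl_continuous|exact: continuous_sin].
- by move=> t t1; rewrite bumpD_out ?mulr0.
- by move=> t t1; rewrite !bumpD_out// !mulr0 subrr.
Qed.

Lemma bsinS k s : bsin k.+1 s = - (2 * pi * s) * bcos k s.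
Proof.
set c := 2 * pi * s.
have [ic _] := trig_bump k.+1 (measurable_sinZ c) (fun t => sin_max _).
have [is_ _] := trig_bump k (measurable_cosZ c) (fun t => cos_max _).
apply/eqP; rewrite mulNr -addr_eq0; apply/eqP.
rewrite /bcos /bsin -/c -RintegralZl// -RintegralD//;
  last exact: (integrableZl measurableT _ is_).
apply: (Rintegral_derive_supp (F := fun t => sin (c * t) * bumpD k t)).
- move=> t; have dc : is_derive t 1 (sin \o ( *%R c)) (cos (c * t) * c).
    apply: is_derive1_comp; apply: (is_derive_eq (is_deriveZ c (is_derive_id t 1))).
    by rewrite /GRing.scale/= mulr1.
  apply: (is_derive_eq (is_deriveM dc (is_derive_bumpD k t))).
  by rewrite /GRing.scale/=; ring.
- move=> t; apply: cvgD; apply: cvgM.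
  + by apply: continuous_comp; [apply: mulrl_continuous|exact: continuous_sin].
  + exact: continuous_bumpD.
  + exact: cvg_cst.
  + apply: cvgM; last exact: continuous_bumpD.
    by apply: continuous_comp; [apply: mulrl_continuous|exact: continuous_cos].
- by move=> t t1; rewrite bumpD_out ?mulr0.
- by move=> t t1; rewrite !bumpD_out// !mulr0 addr0.
Qed.

Definition bump_hat (s : R) : R[i] :=
  cint leb (fun t => expi (- (2 * pi * (t * s))) * (bump t)%:C).

(** Four integrations by parts give s^-4. This is the decay required later: one factor (1 + s^2)^-1
    absorbs the weight <.>^2, the other one is integrable. *)
Lemma bump_hat_le : exists2 C, 0 < C & forall s,
  normc (bump_hat s) <= C / (1 + s ^+ 2) ^+ 2.
Proof.
have [C0 C00 H0] := bumpD_bound 0; have [C4 C40 H4] := bumpD_bound 4.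
(* [bcos 0 s] and [bsin 0 s] contribute 4 (C0 + C4) each; the 1 makes the constant positive. *)
exists (8 * (C0 + C4) + 1); first by lra.
move=> s; have s0 : 0 < 1 + s ^+ 2 by have := sqr_ge0 s; lra.
rewrite ler_pdivlMr ?exprn_gt0//.
have -> : bump_hat s = bcos 0 s +i* (- bsin 0 s).
  rewrite /bump_hat /cint; congr Complex.
    by apply: eq_Rintegral => t _; rewrite [LHS]Re_mulc/= mulr0 subr0 cosN;
      congr (cos _ * _); ring.
  rewrite /bsin -mulN1r -RintegralZl//; last first.
    by case: (trig_bump 0 (measurable_sinZ (2 * pi * s)) (fun t => sin_max _)).
  apply: eq_Rintegral => t _; rewrite [LHS]Im_mulc/= mulr0 add0r sinN mulN1r -mulNr.
  by congr (- sin _ * _); ring.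
have nle : normc (bcos 0 s +i* - bsin 0 s) <= `|bcos 0 s| + `|bsin 0 s|.
  apply: ler_normcP; first exact: addr_ge0.
  rewrite sqr_normcE/= sqrrN -(real_normK (num_real (bcos 0 s))) -(real_normK
    (num_real (bsin 0 s))).
  by have := normr_ge0 (bcos 0 s); have := normr_ge0 (bsin 0 s); nra.
set c := 2 * pi * s.
have c4 (x : R) : s ^+ 4 * `|x| <= `|c ^+ 4 * x|.
  rewrite normrM ler_wpM2r// ger0_norm ?exprn_even_ge0// /c exprMn ler_peMl
    ?exprn_even_ge0//.
  by rewrite exprn_ege1//; have := @pi_ge2 R; lra.
(* The two hypotheses match the two terms of (1 + s^2)^2 <= 2 + 2 s^4: the trivial bound, and the
   one obtained from the fourth derivative. *)
have bound (x : R) : `|x| <= C0 * 2 -> `|c ^+ 4 * x| <= C4 * 2 ->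
    `|x| * (1 + s ^+ 2) ^+ 2 <= 4 * (C0 + C4).
  move=> x0 x4; have := c4 x; have := normr_ge0 x.
  have : (1 + s ^+ 2) ^+ 2 <= 2 + 2 * s ^+ 4.
    by rewrite -subr_ge0 (_ : _ - _ = (1 - s ^+ 2) ^+ 2) ?sqr_ge0//; ring.
  set y := (1 + s ^+ 2) ^+ 2; nra.
have Bc : `|bcos 0 s| * (1 + s ^+ 2) ^+ 2 <= 4 * (C0 + C4).
  apply: bound; first by have [_] := trig_bump 0 (measurable_cosZ c) (fun t =>
    cos_max _); apply.
  have -> : c ^+ 4 * bcos 0 s = bcos 4 s by rewrite bcosS bsinS bcosS bsinS -/c; ring.
  by have [_] := trig_bump 4 (measurable_cosZ c) (fun t => cos_max _); apply.
have Bs : `|bsin 0 s| * (1 + s ^+ 2) ^+ 2 <= 4 * (C0 + C4).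
  apply: bound; first by have [_] := trig_bump 0 (measurable_sinZ c) (fun t =>
    sin_max _); apply.
  have -> : c ^+ 4 * bsin 0 s = bsin 4 s by rewrite bsinS bcosS bsinS bcosS -/c; ring.
  by have [_] := trig_bump 4 (measurable_sinZ c) (fun t => sin_max _); apply.
apply: (@le_trans _ _ ((`|bcos 0 s| + `|bsin 0 s|) * (1 + s ^+ 2) ^+ 2)).
  by rewrite ler_wpM2r// sqr_ge0.
rewrite mulrDl; lra.
Qed.

End bump_fourier.

Section dot_lemmas.
Context {R : realType}.
Variable n : nat.
Implicit Types x y z : 'rV[R]_n.

Lemma dotC x y : dot x y = dot y x.
Proof. by apply: eq_bigr => i _; rewrite mulrC. Qed.

Lemma dotDl x y z : dot (x + y) z = dot x z + dot y z.
Proof. by rewrite /dot -big_split/=; apply: eq_bigr => i _; rewrite mxE mulrDl. Qed.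

Lemma dotZl (c : R) x y : dot (c *: x) y = c * dot x y.
Proof. by rewrite /dot mulr_sumr; apply: eq_bigr => i _; rewrite mxE mulrA. Qed.

Lemma dotNl x y : dot (- x) y = - dot x y.
Proof. by rewrite -scaleN1r dotZl mulN1r. Qed.

Lemma dotBl x y z : dot (x - y) z = dot x z - dot y z.
Proof. by rewrite dotDl dotNl. Qed.

Lemma dotDr x y z : dot x (y + z) = dot x y + dot x z.
Proof. by rewrite dotC dotDl !(dotC x). Qed.

Lemma dotNr x y : dot x (- y) = - dot x y.
Proof. by rewrite dotC dotNl dotC. Qed.

Lemma dotBr x y z : dot x (y - z) = dot x y - dot x z.
Proof. by rewrite dotDr dotNr. Qed.

Lemma dotZr (c : R) x y : dot x (c *: y) = c * dot x y.
Proof. by rewrite dotC dotZl dotC. Qed.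

Lemma dot0l x : dot 0 x = 0.
Proof. by apply: big1 => i _; rewrite mxE mul0r. Qed.

Lemma dot_ge0 x : 0 <= dot x x.
Proof. by apply: sumr_ge0 => i _; rewrite -expr2 sqr_ge0. Qed.

End dot_lemmas.

(** * Inferior limits of extended real sequences *)

Section limn_einf_lemmas.
Context {R : realType}.
Local Open Scope ereal_scope.
Implicit Types u v : (\bar R)^nat.

Lemma le_limn_einf u v : (forall n, u n <= v n) -> limn_einf u <= limn_einf v.
Proof.
move=> uv; rewrite !limn_einf_lim; apply: lee_lim.
- exact: is_cvg_einfs.
- exact: is_cvg_einfs.
- apply: nearW => n; apply: le_ereal_inf_tmp => _ [m /= nm <-].
  by apply: le_trans (uv m); apply: ereal_inf_lbound; exists m.
Qed.

Lemma cvg_limn_einf u (l : \bar R) : u @ \oo --> l -> limn_einf u = l.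
Proof.
move=> ul; rewrite is_cvg_limn_einfE; first exact/cvg_lim.
by apply/cvg_ex; exists l.
Qed.

Lemma limn_einf_le u (c : \bar R) : (forall n, u n <= c) -> limn_einf u <= c.
Proof.
move=> uc; apply: le_trans (le_limn_einf uc) _.
by rewrite (@cvg_limn_einf (fun=> c) c)//; exact: cvg_cst.
Qed.

End limn_einf_lemmas.

(** * Dilated tensor bumps and majorants of their Fourier transforms *)

Section rbump.
Context {R : realType}.
Local Notation leb := (@lebesgue_measure R).
Local Notation lebn := (@lebesgue_rV R).

(** It serves three times: with e tending to 0 as an approximation of the constant 1 in Bessel's
    inequality, likewise as a truncation of Wf, and with a fixed e as the cut-off around z. *)
Definition rbump (e : R) n (x : 'rV[R]_n) : R := \prod_i bump (e * x ord0 i).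

Lemma rbump_ge0 e n (x : 'rV[R]_n) : 0 <= rbump e x.
Proof. by apply: prodr_ge0 => i _; exact: bump_ge0. Qed.

Lemma rbump_le1 e n (x : 'rV[R]_n) : rbump e x <= 1.
Proof.
by apply: prodr_ile1 => i _; rewrite bump_ge0 bump_le1.
Qed.

Lemma measurable_bumpZ e : measurable_fun setT (fun t : R => bump (e * t)).
Proof.
by apply: (measurableT_comp (f := bump));
  [exact: measurable_bumpD|exact: mulrl_measurable].
Qed.

Lemma measurable_rbump e n : measurable_fun setT (@rbump e n).
Proof.
apply: measurable_prodR => i.
exact: (measurableT_comp (measurable_bumpZ e) (measurable_coord i)).
Qed.

Lemma rbump_cvg n (x : 'rV[R]_n) : rbump k.+1%:R^-1 x @[k --> \oo] --> (1 : R).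
Proof.
rewrite /rbump -[X in _ --> X](_ : \prod_(i < n) bump 0 = 1); last first.
  by rewrite big1// => i _; rewrite bump0.
apply: cvg_big => [p|i _]; first exact: mul_continuous.
apply: (@cvg_comp _ _ _ (fun k : nat => k.+1%:R^-1 * x ord0 i) bump _ (nbhs (0 :
  R))); last exact: continuous_bumpD.
rewrite -(mul0r (x ord0 i)); apply: (@cvgM _ _ _ _ _ (fun=> x ord0 i)).
  exact: cvg_harmonic.
exact: cvg_cst.
Qed.

(** The bound of [bump_hat_le] after dilation: a majorant of the Fourier transform of t |-> bump (e
    t). *)
Definition bump_maj (C e s : R) : R := e^-1 * (C / (1 + (s / e) ^+ 2) ^+ 2).

Definition rbump_maj (C e : R) n (w : 'rV[R]_n) : R :=
  \prod_i bump_maj C e (w ord0 i).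

Lemma oneDsqr_int : exists2 K, 0 <= K &
  (\int[leb]_t ((1 + t ^+ 2)^-1)%:E = K%:E)%E.
Proof.
exists pi; first exact: pi_ge0.
have := @ge0_symfun_integralT R (fun t => (1 + t ^+ 2)^-1).
move=> ->.
- rewrite (_ : [set x | _] = `[0, +oo[%classic); last first.
    by apply/seteqP; split => t /=; rewrite in_itv/= andbT.
  by rewrite integral0y_oneDsqr -EFinM; congr EFin; field.
- by move=> t; rewrite invr_ge0 addr_ge0// sqr_ge0.
- exact: continuous_oneDsqrV.
- by move=> t /=; rewrite sqrrN.
Qed.

Lemma measurable_oneDsqrV : measurable_fun setT (fun t : R => (1 + t ^+ 2)^-1).
Proof. by apply: continuous_measurable_fun; exact: continuous_oneDsqrV. Qed.

Lemma oneDsqr_gt0 (t : R) : 0 < 1 + t ^+ 2.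
Proof. by have := sqr_ge0 t; lra. Qed.

Lemma bump_maj_ge0 C e s : 0 <= C -> 0 < e -> 0 <= bump_maj C e s.
Proof.
move=> C0 e0; rewrite mulr_ge0 ?divr_ge0 ?invr_ge0 ?exprn_ge0//; first exact: ltW.
by rewrite ltW// oneDsqr_gt0.
Qed.

Lemma measurable_bump_maj C e : measurable_fun setT (bump_maj C e).
Proof.
have m1 : measurable_fun setT (fun s : R => (1 + (s / e) ^+ 2)^-1).
  apply: (measurableT_comp (f := fun t : R => (1 + t ^+ 2)^-1));
    first exact: measurable_oneDsqrV.
  exact: mulrr_measurable.
have -> : bump_maj C e = (fun s => e^-1 * (C * (1 + (s / e) ^+ 2)^-1 ^+ 2)).
  by apply/funext => s; rewrite /bump_maj exprVn.
do 2 (apply: measurable_funM; first exact: measurable_cst).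
exact: measurable_funX.
Qed.

Lemma measurable_rbump_maj C e n : measurable_fun setT (@rbump_maj C e n).
Proof.
apply: measurable_prodR => i.
exact: (measurableT_comp (measurable_bump_maj C e) (measurable_coord i)).
Qed.

Lemma rbump_maj_ge0 C e n (w : 'rV[R]_n) : 0 <= C -> 0 < e -> 0 <= rbump_maj C e w.
Proof. by move=> C0 e0; apply: prodr_ge0 => i _; exact: bump_maj_ge0. Qed.

(** The substitution s = e t cancels the factor e^-1, so S is chosen before e. The uniformity of
    Bessel's inequality in the regularisation rests on this. *)
Lemma integral_bump_maj C : 0 <= C -> exists2 S, 0 <= S &
  forall e, 0 < e -> (\int[leb]_s (bump_maj C e s)%:E = S%:E)%E.
Proof.
move=> C0; have [K K0 KE] := oneDsqr_int.
have b1 s : bump_maj C 1 s <= C * (1 + s ^+ 2)^-1.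
  rewrite /bump_maj invr1 mul1r mulr1 ler_wpM2l// lef_pV2 ?posrE ?exprn_gt0
    ?oneDsqr_gt0//.
  by rewrite expr2 ler_peMl ?(ltW (oneDsqr_gt0 s))// lerDl sqr_ge0.
have oo : (\int[leb]_s (bump_maj C 1 s)%:E < +oo)%E.
  apply: (@le_lt_trans _ _ (C * K)%:E); last exact: ltry.
  rewrite EFinM -KE -ge0_integralZl_EFin//; last first.
    by apply/measurable_EFinP; exact: measurable_oneDsqrV.
    by move=> t _; rewrite lee_fin invr_ge0 ltW// oneDsqr_gt0.
  apply: ge0_le_integralT => s; first by rewrite lee_fin bump_maj_ge0.
  by rewrite -EFinM lee_fin.
have i0 : (0 <= \int[leb]_s (bump_maj C 1 s)%:E)%E.
  by apply: integral_ge0 => s _; rewrite lee_fin bump_maj_ge0.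
exists (fine (\int[leb]_s (bump_maj C 1 s)%:E)%E); first exact: fine_ge0.
move=> e e0; rewrite fineK ?ge0_fin_numE//.
have ei0 : 0 < e^-1 by rewrite invr_gt0.
have m1 : measurable_fun setT (fun s => (bump_maj C 1 s)%:E).
  by apply/measurable_EFinP; exact: measurable_bump_maj.
have p1 s : (0 <= (bump_maj C 1 s)%:E)%E by rewrite lee_fin bump_maj_ge0.
have A := ge0_integral_affine_gt0 0 ei0 m1 p1.
transitivity (\int[leb]_s (e^-1%:E * (bump_maj C 1 (e^-1 * s + 0))%:E))%E.
  apply: eq_integral => s _; rewrite -EFinM /bump_maj invr1 mul1r mulr1 addr0.
  by rewrite (mulrC e^-1 s).
rewrite ge0_integralZl_EFin ?invr_ge0 ?ltW//.
  by rewrite A muleA invrK -EFinM mulVf ?gt_eqF// mul1e.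
by apply/measurable_EFinP; apply: (measurableT_comp (measurable_bump_maj C 1));
  exact: measurable_affine.
Qed.

Lemma bump_hat_scale e s : 0 < e ->
  let h := fun t => expi (- (2 * pi * (t * s))) * (bump (e * t))%:C in
  cintegrable leb h /\ cint leb h = e^-1%:C * bump_hat (s / e).
Proof.
move=> e0 h.
pose f t := expi (- (2 * pi * (t * (s / e)))) * (bump t)%:C.
have fi : cintegrable leb f.
  split.
    apply: cmeasurableM; last by apply: cmeasurable_real; exact: measurable_bumpD.
    by apply: cmeasurable_expi; apply: measurableT_comp => //;
      apply: measurable_funM => //; exact: mulrr_measurable.
  have [C C0 bC] := bumpD_bound (R := R) 0.
  have [bi _] := integrable_supp (measurable_bumpD 0) bC (fun t => @bumpD_out R 0 t).
  have /integrableP[_] := bi; apply: le_lt_trans; apply: ge0_le_integralT => t.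
    by rewrite lee_fin normc_ge0.
  by rewrite normcM normc_expi mul1r normc_real.
have T (g : R -> \bar R) : measurable_fun setT g -> (forall x, 0 <= g x)%E ->
   (\int[leb]_t g (e * t + 0)%R = e^-1%:E * \int[leb]_t g t)%E.
  by move=> mg g0; exact: ge0_integral_affine_gt0.
have e0' : 0 <= e^-1 by rewrite invr_ge0 ltW.
have [] := cint_transfer e0' (measurable_affine e 0) T fi.
have -> : (fun x => f (e * x + 0)) = h; last by [].
apply/funext => t; rewrite /f /h addr0; congr (expi (- (2 * pi * _)) * _).
by have en0 : e != 0 by [rewrite gt_eqF]; field.
Qed.

Lemma fourier_rbump n e (w : 'rV[R]_n) : 0 < e ->
  fourier (fun x => (rbump e x)%:C) w = \prod_i (e^-1%:C * bump_hat (w ord0 i / e)).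
Proof.
move=> e0; rewrite /fourier -[LHS]/(cint (lebn n) _).
pose h (i : 'I_n) t := expi (- (2 * pi * (t * w ord0 i))) * (bump (e * t))%:C.
transitivity (cint (lebn n) (fun x => \prod_i h i (x ord0 i))).
  apply: cint_ext => x; rewrite /h big_split/= -expi_sum.
  rewrite sumrN -mulr_sumr /rbump rmorph_prod//.
rewrite cint_tensor.
  by apply: eq_bigr => i _; case: (bump_hat_scale (w ord0 i) e0).
by move=> i; case: (bump_hat_scale (w ord0 i) e0).
Qed.

Lemma normc_fourier_rbump : exists2 C, 0 < C &
  forall n e (w : 'rV[R]_n), 0 < e ->
  normc (fourier (fun x => (rbump e x)%:C) w) <= rbump_maj C e w.
Proof.
have [C C0 bC] := @bump_hat_le R; exists C => // n e w e0.
rewrite fourier_rbump// normc_prod; apply: ler_prod => i _.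
rewrite normc_ge0 normcM normc_real gtr0_norm ?invr_gt0// andTb.
by rewrite /bump_maj ler_pM2l ?invr_gt0//; exact: bC.
Qed.

End rbump.

(** * Schur's test and Bessel's inequality *)

Section fourier_bessel.
Context {R : realType}.
Local Notation lebn := (@lebesgue_rV R).
Variable n : nat.
Implicit Types (M : 'rV[R]_n -> R[i]).

Lemma ge0_integral_subr (a : 'rV[R]_n) (g : 'rV[R]_n -> \bar R) :
  measurable_fun setT g -> (forall x, 0 <= g x)%E ->
  (\int[lebn n]_u g (a - u)%R = \int[lebn n]_u g u)%E.
Proof.
move=> mg g0; have N10 : -1 != 0 :> R by rewrite oppr_eq0 oner_eq0.
transitivity (\int[lebn n]_u g ((-1) *: u + a)%R)%E.
  by apply: eq_integral => u _; rewrite scaleN1r addrC.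
by rewrite (ge0_integral_rV_affine a N10 mg g0) normrN1 invr1 expr1n mul1e.
Qed.

Lemma ge0_integral_subl (a : 'rV[R]_n) (g : 'rV[R]_n -> \bar R) :
  measurable_fun setT g -> (forall x, 0 <= g x)%E ->
  (\int[lebn n]_u g (u - a)%R = \int[lebn n]_u g u)%E.
Proof.
move=> mg g0; have O10 : 1 != 0 :> R by rewrite oner_eq0.
transitivity (\int[lebn n]_u g (1 *: u - a)%R)%E.
  by apply: eq_integral => u _; rewrite scale1r.
by rewrite (ge0_integral_rV_affine (- a) O10 mg g0) normr1 invr1 expr1n mul1e.
Qed.

Section schur.
Variables (Psi : 'rV[R]_n -> R) (S : R).
Hypotheses (mPsi : measurable_fun setT Psi) (Psi0 : forall u, 0 <= Psi u).
Hypothesis PsiS : (\int[lebn n]_u (Psi u)%:E <= S%:E)%E.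

Let mPsiE : measurable_fun setT (EFin \o Psi).
Proof. exact/measurable_EFinP. Qed.

Let mPsi2 : measurable_fun setT (fun p : 'rV[R]_n * 'rV[R]_n => Psi (p.1 - p.2)).
Proof.
by apply: (measurableT_comp mPsi); apply: measurable_rVD => //; exact: measurable_rVN.
Qed.

Let mPsil (w : 'rV[R]_n) : measurable_fun setT (fun v : 'rV[R]_n => Psi (w - v)).
Proof.
by apply: (measurableT_comp mPsi); apply: measurable_rVD => //; exact: measurable_rVN.
Qed.

Let mPsir (w : 'rV[R]_n) : measurable_fun setT (fun v : 'rV[R]_n => Psi (v - w)).
Proof.
by apply: (measurableT_comp mPsi); apply: measurable_rVD => //; exact: measurable_cst.
Qed.

(** From 2 M(v) M(u) <= M(v)^2 + M(u)^2: in each half Psi is integrated in the variable that M does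
    not involve, which leaves S/2 times the integral of M^2. *)
Lemma schur_bilinear (M : 'rV[R]_n -> R) : measurable_fun setT M ->
  (forall u, 0 <= M u) ->
  (\int[lebn n]_v \int[lebn n]_u (M v * (M u * Psi (v - u)))%:E <=
   S%:E * \int[lebn n]_v (M v ^+ 2)%:E)%E.
Proof.
move=> mM M0.
have mM1 : measurable_fun setT (fun p : 'rV[R]_n * 'rV[R]_n => M p.1) by exact:
  measurableT_comp.
have mM2 : measurable_fun setT (fun p : 'rV[R]_n * 'rV[R]_n => M p.2) by exact:
  measurableT_comp.
have mMM : measurable_fun setT (fun v => (M v ^+ 2)%:E).
  by apply/measurable_EFinP; exact: measurable_funX.
pose f1 (p : 'rV[R]_n * 'rV[R]_n) := (2^-1 * (M p.1 ^+ 2 * Psi (p.1 - p.2)))%:E.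
pose f2 (p : 'rV[R]_n * 'rV[R]_n) := (2^-1 * (M p.2 ^+ 2 * Psi (p.1 - p.2)))%:E.
have mf1 : measurable_fun setT f1.
  apply/measurable_EFinP; apply: measurable_funM; first exact: measurable_cst.
  by apply: measurable_funM => //; exact: measurable_funX.
have mf2 : measurable_fun setT f2.
  apply/measurable_EFinP; apply: measurable_funM; first exact: measurable_cst.
  by apply: measurable_funM => //; exact: measurable_funX.
have f10 p : (0 <= f1 p)%E by rewrite lee_fin mulr_ge0 ?invr_ge0// mulr_ge0// sqr_ge0.
have f20 p : (0 <= f2 p)%E by rewrite lee_fin mulr_ge0 ?invr_ge0// mulr_ge0// sqr_ge0.
have half (c : R) (g : 'rV[R]_n -> R) : measurable_fun setT g -> (forall u, 0 <= g u)
  -> 0 <= c ->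
    (\int[lebn n]_u (g u)%:E <= S%:E)%E ->
    (\int[lebn n]_u (2^-1 * (c * g u))%:E <= (2^-1 * S)%:E * c%:E)%E.
  move=> mg g0 c0 gS.
  have -> : (\int[lebn n]_u (2^-1 * (c * g u))%:E = (2^-1 * c)%:E * \int[lebn n]_u (g
    u)%:E)%E.
    under eq_integral do rewrite mulrA EFinM.
    apply: ge0_integralZl_EFin => //.
    - by move=> u _; rewrite lee_fin.
    - exact/measurable_EFinP.
    - by rewrite mulr_ge0 ?invr_ge0.
  have -> : ((2^-1 * S)%:E * c%:E = (2^-1 * c)%:E * S%:E)%E.
    by rewrite -!EFinM; congr EFin; ring.
  apply: lee_wpmul2l => //.
  by rewrite lee_fin mulr_ge0 ?invr_ge0.
have S0 : 0 <= S.
  by rewrite -lee_fin; apply: le_trans PsiS; apply: integral_ge0 => u _;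
    rewrite lee_fin.
have S20 : 0 <= 2^-1 * S by rewrite mulr_ge0 ?invr_ge0.
have outer : (\int[lebn n]_v ((2^-1 * S)%:E * (M v ^+ 2)%:E) = (2^-1 * S)%:E *
  \int[lebn n]_v (M v ^+ 2)%:E)%E.
  apply: ge0_integralZl_EFin => //.
  by move=> v _; rewrite lee_fin sqr_ge0.
apply: (@le_trans _ _ (\int[lebn n]_v \int[lebn n]_u (f1 (v, u) + f2 (v, u)))%E).
  apply: ge0_le_integralT => v.
    by apply: integral_ge0 => u _; rewrite lee_fin !mulr_ge0.
  apply: ge0_le_integralT => u; first by rewrite lee_fin !mulr_ge0.
  rewrite -EFinD lee_fin -mulrDr -mulrDl mulrA mulrCA -mulrA mulrCA mulrA.
  have : 0 <= (M v - M u) ^+ 2 by exact: sqr_ge0.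
  have := Psi0 (v - u); set P := Psi _ => P0 sq.
  rewrite -subr_ge0 (_ : _ - _ = 2^-1 * (P * (M v - M u) ^+ 2)); last by field.
  by rewrite mulr_ge0 ?invr_ge0// mulr_ge0.
have -> : (\int[lebn n]_v \int[lebn n]_u (f1 (v, u) + f2 (v, u)) =
    \int[lebn n]_v (\int[lebn n]_u f1 (v, u)) + \int[lebn n]_v (\int[lebn n]_u f2 (v,
      u)))%E.
  rewrite -ge0_integralD//.
  - apply: eq_integral => v _; rewrite ge0_integralD//.
    + exact: (measurableT_comp mf1 (pair1_measurable v)).
    + exact: (measurableT_comp mf2 (pair1_measurable v)).
  - by move=> v _; exact: integral_ge0.
  - exact: measurable_fun_fubini_tonelli_F.
  - by move=> v _; exact: integral_ge0.
  - exact: measurable_fun_fubini_tonelli_F.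
rewrite (fubini_tonelli f2)//.
have -> : (S%:E = (2^-1 * S)%:E + (2^-1 * S)%:E)%E by rewrite -EFinD; congr EFin;
  field.
rewrite ge0_muleDl ?lee_fin// -outer; apply: leeD.
- apply: ge0_le_integralT => v; first exact: integral_ge0.
  apply: (half (M v ^+ 2) (fun u => Psi (v - u))); rewrite ?sqr_ge0//.
  by rewrite (ge0_integral_subr v mPsiE).
- apply: ge0_le_integralT => u; first exact: integral_ge0.
  apply: (half (M u ^+ 2) (fun v => Psi (v - u))); rewrite ?sqr_ge0//.
  by rewrite (ge0_integral_subl u mPsiE).
Qed.

(** Cauchy-Schwarz for the measure Psi(w - v) dv gives I^2 <= S Q pointwise, and Tonelli integrates
    Q. It is derived from Young's inequality with a free parameter a, which also settles the
    finiteness of I. *)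
Lemma schur_square (H : 'rV[R]_n -> R) : 0 < S -> measurable_fun setT H ->
  (forall u, 0 <= H u) ->
  (\int[lebn n]_w (\int[lebn n]_v (Psi (w - v) * H v)%:E) ^+ 2 <=
   (S * S)%:E * \int[lebn n]_v (H v ^+ 2)%:E)%E.
Proof.
move=> S0 mH H0.
have mH2 : measurable_fun setT (fun p : 'rV[R]_n * 'rV[R]_n => H p.2) by exact:
  measurableT_comp.
have mQ : measurable_fun setT (fun p : 'rV[R]_n * 'rV[R]_n => (Psi (p.1 - p.2) * H
  p.2 ^+ 2)%:E).
  by apply/measurable_EFinP; apply: measurable_funM => //; exact: measurable_funX.
pose I (w : 'rV[R]_n) : \bar R := (\int[lebn n]_v (Psi (w - v) * H v)%:E)%E.
pose Q (w : 'rV[R]_n) : \bar R := (\int[lebn n]_v (Psi (w - v) * H v ^+ 2)%:E)%E.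
have I0 w : (0 <= I w)%E by apply: integral_ge0 => v _; rewrite lee_fin mulr_ge0.
have Q0 w : (0 <= Q w)%E by apply: integral_ge0 => v _;
  rewrite lee_fin mulr_ge0// sqr_ge0.
have mI (w : 'rV[R]_n) : measurable_fun setT (fun v : 'rV[R]_n => (Psi (w - v) * H
  v)%:E).
  by apply/measurable_EFinP; exact: measurable_funM.
have mQw (w : 'rV[R]_n) : measurable_fun setT (fun v : 'rV[R]_n => (Psi (w - v) * H v
  ^+ 2)%:E).
  by apply/measurable_EFinP; apply: measurable_funM => //; exact: measurable_funX.
have young a w : 0 <= a -> ((2 * a)%:E * I w <= (a ^+ 2 * S)%:E + Q w)%E.
  move=> a0; have a20 : 0 <= 2 * a by rewrite mulr_ge0.
  rewrite /I -ge0_integralZl_EFin//; last by move=> v _; rewrite lee_fin mulr_ge0.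
  apply: (@le_trans _ _ (\int[lebn n]_v ((a ^+ 2)%:E * (Psi (w - v))%:E + (Psi (w -
    v) * H v ^+ 2)%:E))%E).
    apply: ge0_le_integralT => v; first by rewrite -EFinM lee_fin !mulr_ge0.
    rewrite -!EFinM -EFinD lee_fin -subr_ge0.
    rewrite (_ : _ - _ = Psi (w - v) * (a - H v) ^+ 2); last by ring.
    by rewrite mulr_ge0// sqr_ge0.
  rewrite ge0_integralD//; last 3 first.
  - by move=> v _; rewrite -EFinM lee_fin mulr_ge0// sqr_ge0.
  - by apply/measurable_EFinP; apply: measurable_funM => //; exact: measurable_cst.
  - by move=> v _; rewrite lee_fin mulr_ge0// sqr_ge0.
  rewrite leeD2r// ge0_integralZl_EFin//; last 3 first.
  - by move=> v _; rewrite lee_fin.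
  - exact/measurable_EFinP.
  - exact: sqr_ge0.
  rewrite [leRHS]EFinM; apply: lee_wpmul2l; first by rewrite lee_fin sqr_ge0.
  by rewrite (ge0_integral_subr w mPsiE).
have IQ w : (I w ^+ 2 <= S%:E * Q w)%E.
  have [->|Qoo] := eqVneq (Q w) +oo%E; first by rewrite gt0_muley ?lte_fin// leey.
  have Qfin : Q w \is a fin_num by rewrite ge0_fin_numE// ltey.
  (* The parameter a = 1 shows that I is finite wherever Q is. *)
  have := young 1 w ler01; have := Q0 w; rewrite -(fineK Qfin);
    set q := fine _ => q0 Y1.
  have Ifin : I w \is a fin_num.
    rewrite ge0_fin_numE//; move: Y1; case: (I w) => [r| |]//=; first by rewrite ltry.
    by rewrite gt0_muley// lte_fin mulr1.
  (* The optimal parameter a = I / S turns Young's inequality into I^2 <= S Q. *)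
  have iS : 0 <= fine (I w) / S by rewrite divr_ge0 ?fine_ge0// ltW.
  have := young _ w iS; rewrite -(fineK Qfin) -/q -(fineK Ifin); set i := fine (I w).
  rewrite -EFin_expe -!EFinM -EFinD !lee_fin => Y.
  have : 0 <= S * (((i / S) ^+ 2 * S + q) - 2 * (i / S) * i).
    by rewrite mulr_ge0 ?subr_ge0// ltW.
  rewrite (_ : S * _ = S * q - i ^+ 2) ?subr_ge0//.
  by have S00 : S != 0 by [rewrite gt_eqF]; field.
apply: (@le_trans _ _ (\int[lebn n]_w (S%:E * Q w))%E).
  by apply: ge0_le_integralT => // w; exact: sqre_ge0.
have mQQ : measurable_fun setT Q.
  apply: (measurable_fun_fubini_tonelli_F (fun p : 'rV[R]_n * 'rV[R]_n => (Psi (p.1 -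
    p.2) * H p.2 ^+ 2)%:E) mQ).
  by move=> p; rewrite lee_fin mulr_ge0// sqr_ge0.
have SE : (0 <= S%:E)%E by rewrite lee_fin ltW.
have mHH : measurable_fun setT (fun v => (H v ^+ 2)%:E).
  by apply/measurable_EFinP; exact: measurable_funX.
have HH0 v : (0 <= (H v ^+ 2)%:E)%E by rewrite lee_fin sqr_ge0.
have -> : (\int[lebn n]_w (S%:E * Q w) = S%:E * \int[lebn n]_w Q w)%E.
  by apply: ge0_integralZl_EFin => //; exact: ltW.
rewrite EFinM -muleA; apply: lee_wpmul2l => //.
rewrite /Q (fubini_tonelli (fun p : 'rV[R]_n * 'rV[R]_n => (Psi (p.1 - p.2) * H p.2
  ^+ 2)%:E) mQ); last first.
  by move=> p; rewrite lee_fin mulr_ge0// sqr_ge0.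
have <- : (\int[lebn n]_v (S%:E * (H v ^+ 2)%:E) = S%:E * \int[lebn n]_v (H v ^+
  2)%:E)%E.
  by apply: ge0_integralZl_EFin => //; exact: ltW.
apply: ge0_le_integralT => v.
  by apply: integral_ge0 => w _; rewrite lee_fin mulr_ge0// sqr_ge0.
have -> : (\int[lebn n]_w (Psi (w - v) * H v ^+ 2)%:E = (H v ^+ 2)%:E * \int[lebn
  n]_w (Psi (w - v))%:E)%E.
  under eq_integral do rewrite mulrC EFinM.
  apply: ge0_integralZl_EFin => //.
  - by move=> w _; rewrite lee_fin.
  - by apply/measurable_EFinP.
  - exact: sqr_ge0.
rewrite muleC; apply: lee_wpmul2r => //.
by rewrite (ge0_integral_subl v mPsiE).
Qed.

End schur.

End fourier_bessel.

(** * Bessel's inequality by regularisation *)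

Section bessel.
Context {R : realType}.
Local Notation leb := (@lebesgue_measure R).
Local Notation lebn := (@lebesgue_rV R).

Lemma integral_rbump_maj (C S : R) n : 0 <= C ->
  (forall e, 0 < e -> (\int[leb]_s (bump_maj C e s)%:E = S%:E)%E) ->
  forall e, 0 < e -> (\int[lebn n]_w (rbump_maj C e w)%:E = (S ^+ n)%:E)%E.
Proof.
move=> C0 HS e e0.
rewrite (ge0_integral_tensor (g := fun=> bump_maj C e) (c := fun=> S)) => [|i|i t|i].
- by rewrite prodr_const card_ord.
- exact: measurable_bump_maj.
- exact: bump_maj_ge0.
- exact: HS.
Qed.

Section fixed_dimension.
Variable n : nat.
Implicit Types M : 'rV[R]_n -> R[i].
Local Notation V := ('rV[R]_n).

(** The Fourier kernel: [fourier M w] is convertible to the integral of [wave w v * M v]. *)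
Definition wave (w v : V) : R[i] := expi (- (2 * pi * dot v w)).

Lemma normc_wave w v : normc (wave w v) = 1.
Proof. exact: normc_expi. Qed.

Lemma waveC w v : wave w v = wave v w.
Proof. by rewrite /wave dotC. Qed.

Lemma waveD w v v' : wave w (v + v') = wave w v * wave w v'.
Proof. by rewrite /wave dotDl -expiD mulrDr opprD. Qed.

Lemma conjc_wave w v : conjc (wave w v) = wave w (- v).
Proof. by rewrite /wave conjc_expi dotNl mulrN. Qed.

Lemma cmeasurable_wave d (T : measurableType d) (f g : T -> V) :
  measurable_fun setT f -> measurable_fun setT g ->
  cmeasurable (fun x => wave (f x) (g x)).
Proof.
move=> mf mg; apply: cmeasurable_expi; apply: measurable_funN.
by apply: measurable_funM; [exact: measurable_cst|exact: measurable_dot].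
Qed.

Lemma cintegrable_wave M w : cintegrable (lebn n) M ->
  cintegrable (lebn n) (fun v => wave w v * M v).
Proof.
move=> Mi; apply: (cintegrableMb (K := 1)) Mi.
- by apply: cmeasurable_wave => //; exact: measurable_cst.
- by move=> v; rewrite normc_wave.
Qed.

Lemma cmeasurable_fourier M : cmeasurable M -> cmeasurable (fourier M).
Proof.
move=> mM.
apply: (@cmeasurable_cint _ _ V V R (lebn n) (fun p => wave p.1 p.2 * M p.2)).
apply: cmeasurableM; first exact: cmeasurable_wave.
exact: (cmeasurable_comp measurable_snd mM).
Qed.

Lemma normc_fourier_le M w : cmeasurable M ->
  ((normc (fourier M w))%:E <= \int[lebn n]_v (normc (M v))%:E)%E.
Proof.
move=> mM; apply: (le_trans (normc_cint_le _ _)).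
  apply: cmeasurableM => //; apply: cmeasurable_wave => //; exact: measurable_cst.
by apply: ge0_le_integralT => v;
  rewrite ?lee_fin ?normc_ge0// normcM normc_wave mul1r.
Qed.

Lemma iterated_integral_lty (a b : V -> R) :
  measurable_fun setT a -> measurable_fun setT b ->
  (forall w, 0 <= a w) -> (forall v, 0 <= b v) ->
  (\int[lebn n]_w (a w)%:E < +oo)%E -> (\int[lebn n]_v (b v)%:E < +oo)%E ->
  (\int[lebn n]_w \int[lebn n]_v (a w * b v)%:E < +oo)%E.
Proof.
move=> ma mb a0 b0 aoo boo.
have afin : (\int[lebn n]_v (a v)%:E)%E \is a fin_num.
  by rewrite ge0_fin_numE// integral_ge0// => v _; rewrite lee_fin.
have bfin : (\int[lebn n]_v (b v)%:E)%E \is a fin_num.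
  by rewrite ge0_fin_numE// integral_ge0// => v _; rewrite lee_fin.
pose B := fine (\int[lebn n]_v (b v)%:E)%E.
have B0 : 0 <= B by apply: fine_ge0; apply: integral_ge0 => v _; rewrite lee_fin.
have -> : (\int[lebn n]_w \int[lebn n]_v (a w * b v)%:E = \int[lebn n]_w (B%:E * (a
  w)%:E))%E.
  apply: eq_integral => w _; rewrite /B fineK// muleC.
  under eq_integral do rewrite EFinM.
  apply: ge0_integralZl_EFin => //; last by apply/measurable_EFinP.
  by move=> v _; rewrite lee_fin.
rewrite ge0_integralZl_EFin//; last 2 first.
- by move=> w _; rewrite lee_fin.
- by apply/measurable_EFinP.
by rewrite -(fineK afin) -EFinM ltry.
Qed.

(** The multiplication formula; Fubini applies since the kernel has modulus 1 and M(v) N(w) is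
    integrable in both variables. *)
Lemma cint_fourier M N : cintegrable (lebn n) M -> cintegrable (lebn n) N ->
  cint (lebn n) (fun w => N w * fourier M w) =
  cint (lebn n) (fun v => M v * fourier N v).
Proof.
move=> Mi Ni; have [mM Moo] := Mi; have [mN Noo] := Ni.
pose F (p : V * V) := N p.1 * (wave p.1 p.2 * M p.2).
have mF : cmeasurable F.
  apply: cmeasurableM; first exact: (cmeasurable_comp measurable_fst mN).
  apply: cmeasurableM; first exact: cmeasurable_wave.
  exact: (cmeasurable_comp measurable_snd mM).
transitivity (cint (lebn n) (fun w => cint (lebn n) (fun v => F (w, v)))).
  by apply: cint_ext => w; rewrite /fourier -[cintegral _]/(cint (lebn n) _) cintZ//;
    exact: cintegrable_wave.
rewrite cint_fubini//.
  apply: cint_ext => v; rewrite /fourier -[cintegral _]/(cint (lebn n) _) cintZ;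
    last exact: cintegrable_wave.
  by apply: cint_ext => w; rewrite /F/= -[expi _]/(wave v w) [wave w v]waveC; ring.
apply: le_lt_trans (iterated_integral_lty (measurable_normc mN) (measurable_normc mM)
  (fun=> normc_ge0 _) (fun=> normc_ge0 _) Noo Moo).
apply: ge0_le_integralT => w; first by apply: integral_ge0 => v _;
  rewrite lee_fin normc_ge0.
apply: ge0_le_integralT => v; first by rewrite lee_fin normc_ge0.
by rewrite lee_fin /F/= !normcM normc_wave mul1r.
Qed.

Lemma fourier_conj M w : cintegrable (lebn n) M ->
  conjc (fourier M w) = cint (lebn n) (fun u => wave w (- u) * conjc (M u)).
Proof.
move=> Mi; rewrite /fourier -[cintegral _]/(cint (lebn n) _) conjc_cint;
  last exact: cintegrable_wave.
by apply: cint_ext => u; rewrite -[expi _]/(wave w u) -conjc_wave; exact: rmorphM.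
Qed.

Lemma cintegrable_rbump e : 0 < e -> cintegrable (lebn n) (fun x : V => (rbump e
  x)%:C).
Proof.
move=> e0.
have -> : (fun x : V => (rbump e x)%:C) = (fun x => \prod_i (fun t => (bump (e *
  t))%:C) (x ord0 i)).
  by apply/funext => x; rewrite /rbump rmorph_prod.
apply: (cintegrable_tensor (h := fun _ t => (bump (e * t))%:C)) => i.
split; first by apply: cmeasurable_real; exact: measurable_bumpZ.
have [[_ H] _] := bump_hat_scale 0 e0; apply: le_lt_trans H.
apply: ge0_le_integralT => t; first by rewrite lee_fin normc_ge0.
by rewrite normcM normc_expi mul1r.
Qed.

(** The factor [rbump e] stands for the constant 1. As M^ is bounded by the L^1 norm of M, it makes
    N integrable, so that the multiplication formula applies; what remains is a bilinear form in |M|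
    for Schur's test. *)
Lemma bessel_rbump M e (C S : R) : 0 < e -> 0 <= C ->
  (forall w : V, normc (fourier (fun x => (rbump e x)%:C) w) <= rbump_maj C e w) ->
  (\int[lebn n]_w (rbump_maj C e w)%:E <= S%:E)%E ->
  cintegrable (lebn n) M ->
  (\int[lebn n]_w (rbump e w * normc (fourier M w) ^+ 2)%:E <=
   S%:E * \int[lebn n]_v (normc (M v) ^+ 2)%:E)%E.
Proof.
move=> e0 C0 BC BS Mi; have [mM Moo] := Mi.
pose N w := (rbump e w)%:C * conjc (fourier M w).
have mB : cmeasurable (fun w : V => (rbump e w)%:C) by apply: cmeasurable_real;
  exact: measurable_rbump.
have mfM := cmeasurable_fourier mM.
have mN : cmeasurable N by apply: cmeasurableM => //; exact: cmeasurable_conj.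
have Bi := cintegrable_rbump e0.
have Mfin : (\int[lebn n]_v (normc (M v))%:E)%E \is a fin_num.
  by rewrite ge0_fin_numE// integral_ge0// => v _; rewrite lee_fin normc_ge0.
pose m := fine (\int[lebn n]_v (normc (M v))%:E)%E.
have fm w : normc (fourier M w) <= m by rewrite -lee_fin fineK//;
  exact: normc_fourier_le.
have Ni : cintegrable (lebn n) N.
  have -> : N = (fun w => conjc (fourier M w) * (rbump e w)%:C) by apply/funext => w;
    rewrite mulrC.
  apply: (cintegrableMb (K := m)) => //; first exact: cmeasurable_conj.
  by move=> w; rewrite normc_conj.
(* the left-hand side is [int N * fourier M] *)
pose P w := rbump e w * normc (fourier M w) ^+ 2.
have PE w : N w * fourier M w = (P w)%:C.
  by rewrite /N -mulrA [conjc _ * _]mulrC mul_conjc -rmorphM.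
have P0 w : 0 <= P w by rewrite mulr_ge0 ?rbump_ge0// sqr_ge0.
have Pi : cintegrable (lebn n) (fun w => (P w)%:C).
  have -> : (fun w => (P w)%:C) = (fun w => fourier M w * N w).
    by apply/funext => w; rewrite -PE mulrC.
  exact: (cintegrableMb (K := m)).
have -> : (\int[lebn n]_w (P w)%:E = (normc (cint (lebn n) (fun w => N w * fourier M
  w)))%:E)%E.
  have fin : (\int[lebn n]_w (P w)%:E)%E \is a fin_num.
    rewrite ge0_fin_numE; last by apply: integral_ge0 => w _; rewrite lee_fin.
    case: Pi => _; apply: le_lt_trans; apply: ge0_le_integralT => w;
      rewrite ?lee_fin//.
    by rewrite normc_real ler_norm.
  rewrite (cint_ext _ PE) cint_real normc_real ger0_norm; last exact: Rintegral_ge0.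
  by rewrite fineK.
rewrite cint_fourier//.
(* the Fourier transform of N is the convolution of conj M with that of B *)
have NE v : fourier N v = cint (lebn n) (fun u => conjc (M u) * fourier (fun x =>
  (rbump e x)%:C) (v - u)).
  pose F (p : V * V) := wave v p.1 * ((rbump e p.1)%:C * (wave p.1 (- p.2) * conjc (M
    p.2))).
  have mF : cmeasurable F.
    apply: cmeasurableM; first by apply: cmeasurable_wave => //;
      exact: measurable_cst.
    apply: cmeasurableM; first exact: (cmeasurable_comp measurable_fst mB).
    apply: cmeasurableM; first by apply: cmeasurable_wave => //;
      exact: measurable_rVN.
    by apply: cmeasurable_conj; exact: (cmeasurable_comp measurable_snd mM).
  have cMi w : cintegrable (lebn n) (fun u => wave w (- u) * conjc (M u)).
    apply: (cintegrableMb (K := 1)).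
    - by apply: cmeasurable_wave; [exact: measurable_cst|exact: measurable_rVN].
    - by move=> u; rewrite normc_wave.
    - split; first exact: cmeasurable_conj.
      by under eq_integral do rewrite normc_conj.
  transitivity (cint (lebn n) (fun w => cint (lebn n) (fun u => F (w, u)))).
    apply: cint_ext => w; rewrite /N fourier_conj// cintZ// -[expi _]/(wave v w)
      cintZ//.
    exact: cintegrableZ.
  rewrite cint_fubini//.
    apply: cint_ext => u; rewrite /fourier -[cintegral _]/(cint (lebn n) _) cintZ;
      last exact: cintegrable_wave.
    apply: cint_ext => w; rewrite /F/= -[expi _]/(wave (v - u) w).
    by rewrite [wave (v - u) w]waveC waveD (waveC w v); ring.
  have [_ Boo] := Bi.
  apply: le_lt_trans (iterated_integral_lty (measurable_normc mB) (measurable_normc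
    mM)
    (fun=> normc_ge0 _) (fun=> normc_ge0 _) Boo Moo).
  apply: ge0_le_integralT => w; first by apply: integral_ge0 => u _;
    rewrite lee_fin normc_ge0.
  apply: ge0_le_integralT => u; first by rewrite lee_fin normc_ge0.
  by rewrite lee_fin /F/= !normcM !normc_wave normc_conj !mul1r.
apply: le_trans (normc_cint_le _ _) _.
  by apply: cmeasurableM => //; exact: cmeasurable_fourier.
apply: (le_trans _ (schur_bilinear (@measurable_rbump_maj R C e n)
  (fun u => rbump_maj_ge0 u C0 e0) BS (measurable_normc mM) (fun=> normc_ge0 _))).
apply: ge0_le_integralT => v; first by rewrite lee_fin normc_ge0.
rewrite normcM EFinM.
have mMv : measurable_fun setT (fun u => (normc (M u) * rbump_maj C e (v - u))%:E).
  apply/measurable_EFinP; apply: measurable_funM; first exact: measurable_normc.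
  apply: (measurableT_comp (@measurable_rbump_maj R C e n)).
  by apply: measurable_rVD => //; exact: measurable_rVN.
have -> : (\int[lebn n]_u (normc (M v) * (normc (M u) * rbump_maj C e (v - u)))%:E =
    (normc (M v))%:E * \int[lebn n]_u (normc (M u) * rbump_maj C e (v - u))%:E)%E.
  under eq_integral do rewrite EFinM.
  apply: ge0_integralZl_EFin => //; last exact: normc_ge0.
  by move=> u _; rewrite lee_fin mulr_ge0 ?normc_ge0// rbump_maj_ge0.
apply: lee_wpmul2l; first by rewrite lee_fin normc_ge0.
rewrite NE; apply: le_trans (normc_cint_le _ _) _.
  apply: cmeasurableM; first exact: cmeasurable_conj.
  apply: (cmeasurable_comp (f := fourier _)); last exact: cmeasurable_fourier.
  by apply: measurable_rVD => //; exact: measurable_rVN.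
apply: ge0_le_integralT => u; first by rewrite lee_fin normc_ge0.
by rewrite lee_fin normcM normc_conj ler_wpM2l// normc_ge0.
Qed.

(** Fatou's lemma for e = 1/(k + 1), with the bound S^n, one factor S per coordinate, that is common
    to all e. *)
Lemma bessel : exists2 K, 0 <= K & forall M, cintegrable (lebn n) M ->
  (\int[lebn n]_w (normc (fourier M w) ^+ 2)%:E <=
   K%:E * \int[lebn n]_v (normc (M v) ^+ 2)%:E)%E.
Proof.
have [C /ltW C0 BC] := @normc_fourier_rbump R.
have [S S0 HS] := integral_bump_maj C0.
exists (S ^+ n); first exact: exprn_ge0.
move=> M Mi; have [mM _] := Mi.
pose f (k : nat) w := (rbump k.+1%:R^-1 w * normc (fourier M w) ^+ 2)%:E.
have mN := measurable_normc (cmeasurable_fourier mM).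
have -> : (\int[lebn n]_w (normc (fourier M w) ^+ 2)%:E = \int[lebn n]_w limn_einf (f
  ^~ w))%E.
  apply: eq_integral => w _; apply/esym/cvg_limn_einf.
  apply: cvg_EFin; first by near=> k.
  rewrite -[X in _ --> X]mul1r; apply: cvgM; last exact: cvg_cst.
  exact: rbump_cvg.
apply: le_trans (fatou _ _ _ _) _ => //.
- move=> k; apply/measurable_EFinP; apply: measurable_funM;
    first exact: measurable_rbump.
  exact: measurable_funX.
- by move=> k w _; rewrite lee_fin mulr_ge0 ?rbump_ge0// sqr_ge0.
apply: limn_einf_le => k; apply: (bessel_rbump (C := C)) => //.
- by move=> w; apply: BC.
- by rewrite (integral_rbump_maj n C0 HS).
Unshelve. all: by end_near. Qed.

End fixed_dimension.

End bessel.

(** * The tensor bump is a test function *)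

Section rbump_test_function.
Context {R : realType}.
Variable n : nat.
Local Notation V := ('rV[R]_n).

(** D describes G on the line through x of direction v, with parameter t at x; a partial derivative
    becomes a one-variable one. *)
Lemma is_derive_along (G : V -> R) (D : R -> R) (x v : V) (t d : R) :
  (forall h : R, G (h *: v + x) = D (h + t)) -> is_derive t 1 D d ->
  is_derive x v G d.
Proof.
move=> GD [dD dE].
have E : (fun h : R => h^-1 *: ((G \o shift x) (h *: v) - G x)) =
         (fun h : R => h^-1 *: ((D \o shift t) (h *: 1) - D t)).
  apply/funext => h; rewrite /= GD.
  have := GD 0; rewrite scale0r !add0r => ->.
  by rewrite [h *: 1]mulr1.
apply: DeriveDef; first by rewrite /derivable E; exact: dD.
by rewrite /derive E; exact: dE.
Qed.

Variables (e : R).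

(** The partial derivative of [rbump e] of multi-index k; each derivation brings out a factor e. *)
Definition rbumpD (k : 'I_n -> nat) (x : V) : R :=
  \prod_i (e ^+ k i * bumpD (k i) (e * x ord0 i)).

Lemma is_derive_rbumpD (k : 'I_n -> nat) (j : 'I_n) (x : V) :
  is_derive x (delta_mx ord0 j) (rbumpD k)
    (rbumpD (fun i => (i == j) + k i)%N x).
Proof.
pose c := \prod_(i | i != j) (e ^+ k i * bumpD (k i) (e * x ord0 i)).
apply: (is_derive_along (t := x ord0 j)
  (D := fun t => c * e ^+ k j * bumpD (k j) (e * t))).
  move=> h; rewrite /rbumpD (bigD1 j)//= !mxE !eqxx mulr1 mulrC mulrA;
    congr (_ * _ * _).
  by apply: eq_bigr => i ij; rewrite !mxE (negbTE ij) andbF mulr0 add0r.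
have dc : is_derive (x ord0 j) 1 (bumpD (k j) \o ( *%R e)) (bumpD (k j).+1 (e * x
  ord0 j) * e).
  apply: is_derive1_comp; first exact: is_derive_bumpD.
  apply: (is_derive_eq (is_deriveZ e (is_derive_id (x ord0 j) 1))).
  by rewrite /GRing.scale/= mulr1.
apply: (is_derive_eq (is_deriveZ (c * e ^+ k j) dc)).
rewrite /GRing.scale/= /rbumpD (bigD1 j)//= eqxx add1n exprS.
rewrite (eq_bigr (fun i => e ^+ k i * bumpD (k i) (e * x ord0 i))) -/c; last first.
  by move=> i /negbTE ->.
by ring.
Qed.

Lemma continuous_rbumpD k : continuous (rbumpD k).
Proof.
apply: continuous_big => [p|i _]; first exact: mul_continuous.
move=> x.
pose h (t : R) := e ^+ k i * bumpD (k i) (e * t).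
apply: (@cvg_comp _ _ _ (fun y : V => y ord0 i) h _ (nbhs (x ord0 i))).
  exact: coord_continuous.
apply: cvgM; first exact: cvg_cst.
by apply: continuous_comp; [exact: mulrl_continuous|exact: continuous_bumpD].
Qed.

Lemma iter_partial_rbumpD (s : seq 'I_n) k :
  iter_partial s (rbumpD k) = rbumpD (fun i => count_mem i s + k i)%N.
Proof.
elim: s => [|j s IH] //=; rewrite IH; apply/funext => x.
rewrite /partial; have [_ ->] := is_derive_rbumpD (fun i => (count_mem i s + k i)%N)
  j x.
by congr rbumpD; apply/funext => i; rewrite addnA [j == i]eq_sym.
Qed.

Lemma smooth_rbumpD k : smooth (rbumpD k).
Proof.
move=> s; rewrite iter_partial_rbumpD; split; first exact: continuous_rbumpD.
by move=> i x; case: (is_derive_rbumpD (fun i => (count_mem i s + k i)%N) i x).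
Qed.

Lemma smooth_cst0 : smooth (fun _ : V => 0 : R).
Proof.
move=> s; have -> : iter_partial s (fun _ : V => 0 : R) = cst 0.
  elim: s => [//|j s /= ->]; apply/funext => x.
  by rewrite /partial derive_cst.
by split => [|i x]; [exact: cst_continuous|exact: derivable_cst].
Qed.

Lemma rbumpE : (fun x : V => rbump e x) = rbumpD (fun=> 0%N).
Proof. by apply/funext => x; apply: eq_bigr => i _; rewrite expr0 mul1r. Qed.

Lemma test_function_rbump : 0 < e ->
  test_function (fun x : V => (rbump e x)%:C).
Proof.
move=> e0; split.
  split => /=; last exact: smooth_cst0.
  by rewrite rbumpE; exact: smooth_rbumpD.
(* The closed cube of half-side 1/e contains every point where the bump is nonzero, hence also their
   closure. *)
pose A (i : 'I_n) : set R := [set` `[- e^-1, e^-1]].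
have cA : compact [set v : V | forall i, A i (v ord0 i)].
  by apply: rV_compact => i; exact: segment_compact.
apply: (subclosed_compact _ cA); first exact: closed_closure.
have clA := compact_closed (@norm_hausdorff _ V) cA.
rewrite [X in _ `<=` X]((closure_id _).1 clA); apply: closureS => x /= x0 i.
rewrite /A /= in_itv/= -ler_norml leNgt; apply/negP => xi.
have : rbump e x == 0.
  rewrite /rbump (bigD1 i)//= /bump bumpD_out ?mul0r//.
  rewrite normrM (gtr0_norm e0) -ler_pdivrMl// mulr1; exact: ltW.
by move=> /eqP r0; rewrite r0 eqxx in x0.
Qed.

End rbump_test_function.

(** * The Wigner distribution *)

Section L2.
Context {R : realType}.
Local Notation lebn := (@lebesgue_rV R).

(** The majorant h is extended-valued because it will be an inferior limit, to be integrated by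
    Fatou's lemma. *)
Lemma L2norm_lty n (A : set 'rV[R]_n) (g : 'rV[R]_n -> R[i]) (h : 'rV[R]_n -> \bar R)
  :
  (forall x, A x -> (normc (g x) ^+ 2)%:E <= h x)%E -> (forall x, 0 <= h x)%E ->
  (\int[lebn n]_x h x < +oo)%E -> (L2norm A g < +oo)%E.
Proof.
move=> gh h0 hoo; rewrite /L2norm unlock; apply: poweR_lty.
apply: le_lt_trans hoo; apply: ge0_le_integralT => x; first exact: poweR_ge0.
rewrite patchE; case: ifPn => [/set_mem/gh|_].
  by rewrite /= ger0_norm ?normc_ge0// powR_mulrn ?normc_ge0.
by rewrite abse0 poweR0r.
Qed.

Lemma L2norm_integral n (g : 'rV[R]_n -> R[i]) : (L2norm setT g < +oo)%E ->
  (\int[lebn n]_x (normc (g x) ^+ 2)%:E < +oo)%E.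
Proof.
rewrite /L2norm patch_setT => /poweR_lty - /(_ 2).
rewrite poweR_Lnorm//; apply: le_lt_trans.
apply: ge0_le_integralT => x; first by rewrite lee_fin sqr_ge0.
by rewrite /= ger0_norm ?normc_ge0// powR_mulrn ?normc_ge0.
Qed.

Section wigner.
Variables (d : nat) (f : 'rV[R]_d -> R[i]).
Hypothesis mf : cmeasurable f.
Hypothesis foo : (\int[lebn d]_x (normc (f x) ^+ 2)%:E < +oo)%E.
Local Notation V := ('rV[R]_d).

Let F (x : V) : R := normc (f x) ^+ 2.

Let mF : measurable_fun setT F.
Proof. by apply: measurable_funX; exact: measurable_normc. Qed.

Let F0 x : 0 <= F x. Proof. exact: sqr_ge0. Qed.

Let wig (x y : V) : R[i] := f (x + 2^-1 *: y) * conjc (f (x - 2^-1 *: y)).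

Let mwig d1 (T : measurableType d1) (u v : T -> V) :
  measurable_fun setT u -> measurable_fun setT v ->
  cmeasurable (fun p => wig (u p) (v p)).
Proof.
move=> mu mv; apply: cmeasurableM.
  by apply: (cmeasurable_comp _ mf); apply: measurable_rVD => //;
    exact: measurable_rVZ.
apply: cmeasurable_conj; apply: (cmeasurable_comp _ mf).
by apply: measurable_rVD => //; apply: measurable_rVN; exact: measurable_rVZ.
Qed.

(** For every x the integrand is at most |f(x + y/2)|^2 + |f(x - y/2)|^2, and both terms are
    integrable in y by an affine change of variable. *)
Let wigi x : cintegrable (lebn d) (wig x).
Proof.
have half0 : 2^-1 != 0 :> R by rewrite invr_neq0.
have mFE : measurable_fun setT (EFin \o F) by exact/measurable_EFinP.
pose a (y : V) := (F (2^-1 *: y + x))%:E.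
pose b (y : V) := (F (- 2^-1 *: y + x))%:E.
have ma : measurable_fun setT a.
  apply: (measurableT_comp mFE); apply: measurable_rVD; last exact: measurable_cst.
  exact: measurable_rVZ.
have mb : measurable_fun setT b.
  apply: (measurableT_comp mFE); apply: measurable_rVD; last exact: measurable_cst.
  exact: measurable_rVZ.
have fin (c : R) : c != 0 -> (\int[lebn d]_y (F (c *: y + x))%:E < +oo)%E.
  move=> c0; rewrite (ge0_integral_rV_affine x c0 mFE)//.
  have Ffin : (\int[lebn d]_y (F y)%:E)%E \is a fin_num.
    by rewrite ge0_fin_numE// integral_ge0// => y _; rewrite lee_fin.
  by rewrite /= -(fineK Ffin) -EFinM ltry.
apply: (cintegrable_le (h := fun y => a y + b y)%E).
- by apply: mwig => //; exact: measurable_cst.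
- move=> y; rewrite normcM normc_conj /a /b -EFinD lee_fin /F.
  rewrite (addrC x) (_ : x - 2^-1 *: y = - 2^-1 *: y + x);
    last by rewrite addrC scaleNr.
  by have := normc_ge0 (f (2^-1 *: y + x)); have := normc_ge0 (f (- 2^-1 *: y + x));
    nra.
- rewrite ge0_integralD//; last 2 first.
  + by move=> y _; rewrite lee_fin.
  + by move=> y _; rewrite lee_fin.
  by rewrite lte_add_pinfty ?fin// oppr_eq0.
Qed.

Lemma wigner_fourier x w : wigner f (row_mx x w) = fourier (wig x) w.
Proof.
rewrite /wigner row_mxKl row_mxKr /fourier; apply: cint_ext => y.
by rewrite mulrC.
Qed.

Lemma cmeasurable_wigner : cmeasurable (wigner f).
Proof.
pose G (p : 'rV[R]_(d + d) * V) := wig (lsubmx p.1) p.2 * wave (rsubmx p.1) p.2.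
apply: (cmeasurable_cint (lebn d) (f := G)); apply: cmeasurableM.
  by apply: mwig => //; exact: measurable_lsubmx.
by apply: cmeasurable_wave => //; exact: measurable_rsubmx.
Qed.

Lemma integral_wigner_lty :
  (\int[lebn (d + d)]_z (normc (wigner f z) ^+ 2)%:E < +oo)%E.
Proof.
have [K K0 HK] := @bessel R d.
have mW := measurable_normc cmeasurable_wigner.
rewrite (integral_row_mx (m := d) (n := d)); last 2 first.
- by apply/measurable_EFinP; exact: measurable_funX.
- by move=> z; rewrite lee_fin sqr_ge0.
have half0 : 2^-1 != 0 :> R by rewrite invr_neq0.
have two0 : 2 != 0 :> R by [].
have mFE : measurable_fun setT (EFin \o F) by exact/measurable_EFinP.
have Ffin : (\int[lebn d]_y (F y)%:E)%E \is a fin_num.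
  by rewrite ge0_fin_numE// integral_ge0// => y _; rewrite lee_fin.
pose S := fine (\int[lebn d]_y (F y)%:E)%E.
(* With u = x + y/2 at fixed x, of Jacobian factor c, one has x - y/2 = 2 x - u. The integral of [H]
   then factors after Tonelli, the change x |-> 2 x - u at fixed u giving c'. *)
pose c := (`|2^-1 : R|^-1) ^+ d; pose c' := (`|2 : R|^-1) ^+ d.
pose H (p : V * V) := (F p.2 * F (2 *: p.1 - p.2))%:E.
have mH : measurable_fun setT H.
  apply/measurable_EFinP; apply: measurable_funM; first exact: (measurableT_comp mF).
  apply: (measurableT_comp mF); apply: measurable_rVD; first exact: measurable_rVZ.
  exact: measurable_rVN.
have H0 p : (0 <= H p)%E by rewrite lee_fin mulr_ge0.
have c0 : 0 <= c by rewrite exprn_ge0// invr_ge0.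
apply: (@le_lt_trans _ _ (\int[lebn d]_x ((K * c)%:E * \int[lebn d]_u H (x, u)))%E).
  apply: ge0_le_integralT => x.
    by apply: integral_ge0 => w _; rewrite lee_fin sqr_ge0.
  under eq_integral do rewrite wigner_fourier.
  apply: le_trans (HK _ (wigi x)) _; rewrite EFinM -muleA; apply: lee_wpmul2l;
    first by rewrite lee_fin.
  have mHx : measurable_fun setT (fun u => H (x, u)) by exact: (measurableT_comp mH
    (pair1_measurable x)).
  rewrite -(ge0_integral_rV_affine x half0 mHx)//; apply: ge0_le_integralT => y.
    by rewrite lee_fin sqr_ge0.
  rewrite /wig normcM normc_conj.
  have -> : x - 2^-1 *: y = 2 *: x - (2^-1 *: y + x).
    by apply/rowP => i; rewrite !mxE; ring.
  by rewrite [x + _]addrC lee_fin /H/= /F -exprMn.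
have mI : measurable_fun setT (fun x : V => \int[lebn d]_u H (x, u))%E.
  exact: measurable_fun_fubini_tonelli_F.
have I0 (x : V) : (0 <= \int[lebn d]_u H (x, u))%E by exact: integral_ge0.
have -> : (\int[lebn d]_x ((K * c)%:E * \int[lebn d]_u H (x, u)) =
    (K * c)%:E * \int[lebn d]_x \int[lebn d]_u H (x, u))%E.
  by apply: ge0_integralZl_EFin => //; exact: mulr_ge0.
rewrite (fubini_tonelli H)//.
have -> : (\int[lebn d]_u \int[lebn d]_x H (x, u) = \int[lebn d]_u ((c' * S)%:E * (F
  u)%:E))%E.
  apply: eq_integral => u _; rewrite /H/= muleC.
  have mFu : measurable_fun setT (fun x : V => (F (2 *: x - u))%:E).
    apply: (measurableT_comp mFE); apply: measurable_rVD; last exact: measurable_cst.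
    exact: measurable_rVZ.
  under eq_integral do rewrite EFinM.
  rewrite ge0_integralZl_EFin//; last by move=> x _; rewrite lee_fin.
  by congr (_ * _)%E; rewrite (ge0_integral_rV_affine (- u) two0 mFE)// EFinM /S
    fineK.
have -> : (\int[lebn d]_u ((c' * S)%:E * (F u)%:E) = (c' * S)%:E * \int[lebn d]_u (F
  u)%:E)%E.
  apply: ge0_integralZl_EFin => //.
  - by move=> u _; rewrite lee_fin.
  - rewrite mulr_ge0 ?exprn_ge0 ?invr_ge0// fine_ge0// integral_ge0// => u _.
    by rewrite lee_fin.
by rewrite -(fineK Ffin) -!EFinM ltry.
Qed.

End wigner.
End L2.

(** * Pairing with the Fourier transform of Theta *)

Section symplectic_fourier.
Context {R : realType}.
Local Notation lebn := (@lebesgue_rV R).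
Variable d : nat.
Local Notation V := ('rV[R]_(d + d)).

Lemma dot_row_mx m n (x y : 'rV[R]_(m + n)) :
  dot x y = dot (lsubmx x) (lsubmx y) + dot (rsubmx x) (rsubmx y).
Proof.
rewrite /dot big_split_ord/=.
by congr (_ + _); apply: eq_bigr => i _; rewrite !mxE.
Qed.

(** J is orthogonal, so its transpose is its inverse. *)
Lemma dot_symplectic (a u : V) : dot (symplectic a) u = dot a (symplectic_inv u).
Proof.
rewrite !dot_row_mx !row_mxKl !row_mxKr dotNl dotNr addrC.
by rewrite [dot (rsubmx _) _]dotC [dot (lsubmx _) _]dotC; congr (- _ + _);
  rewrite dotC.
Qed.

Lemma measurable_symplectic_inv d1 (T : measurableType d1) (f : T -> V) :
  measurable_fun setT f -> measurable_fun setT (fun x => symplectic_inv (f x)).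
Proof.
move=> mf; apply: measurable_row_mx; last exact: measurable_lsubmx.
by apply: measurable_rVN; exact: measurable_rsubmx.
Qed.

Lemma measurable_symplectic d1 (T : measurableType d1) (f : T -> V) :
  measurable_fun setT f -> measurable_fun setT (fun x => symplectic (f x)).
Proof.
move=> mf; apply: measurable_row_mx; first exact: measurable_rsubmx.
by apply: measurable_rVN; exact: measurable_lsubmx.
Qed.

Lemma cint_symplectic (a : V) (g : V -> R[i]) : cintegrable (lebn (d + d)) g ->
  cint (lebn (d + d)) (fun z => g (a + symplectic_inv z)) = cint (lebn (d + d)) g.
Proof.
move=> gi; have ms : measurable_fun setT (fun z : V => a + symplectic_inv z).
  by apply: measurable_rVD; [exact: measurable_cst|exact: measurable_symplectic_inv].
have T (h : V -> \bar R) : measurable_fun setT h -> (forall x, 0 <= h x)%E ->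
    (\int[lebn (d + d)]_z h (a + symplectic_inv z)%R = 1%:E * \int[lebn (d + d)]_z h
      z)%E.
  by move=> mh h0; rewrite mul1e ge0_integral_symplectic.
by have [_ ->] := cint_transfer ler01 ms T gi; rewrite mul1r.
Qed.

Lemma cint_subr n (a : 'rV[R]_n) (g : 'rV[R]_n -> R[i]) : cintegrable (lebn n) g ->
  cintegrable (lebn n) (fun z => g (a - z)) /\
  cint (lebn n) (fun z => g (a - z)) = cint (lebn n) g.
Proof.
move=> gi; have ms : measurable_fun setT (fun z : 'rV[R]_n => a - z).
  by apply: measurable_rVD; [exact: measurable_cst|exact: measurable_rVN].
have T (h : 'rV[R]_n -> \bar R) : measurable_fun setT h -> (forall x, 0 <= h x)%E ->
    (\int[lebn n]_z h (a - z)%R = 1%:E * \int[lebn n]_z h z)%E.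
  by move=> mh h0; rewrite mul1e ge0_integral_subr.
by have [i1 ->] := cint_transfer ler01 ms T gi; rewrite mul1r.
Qed.

Lemma sinc_even (t : R) : sinc (- t) = sinc t.
Proof.
rewrite /sinc oppr_eq0; case: ifP => // _.
by rewrite mulrN sinN invrN mulrNN.
Qed.

Lemma normr_sin_le (t : R) : `|sin t| <= `|t|.
Proof.
have pos (x : R) : 0 <= x -> `|sin x| <= `|x|.
  move=> x0; have [c _] := MVT_segment x0 (fun y _ => is_derive_sin y)
    (continuous_subspaceT (@continuous_sin R)).
  by rewrite sin0 !subr0 => ->; rewrite normrM ler_piMl// cos_max.
have [/pos//|/ltW t0] := leP 0 t.
by rewrite -normrN -sinN -[leRHS]normrN pos// oppr_ge0.
Qed.

Lemma sinc_le1 (t : R) : `|sinc t| <= 1.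
Proof.
rewrite /sinc; case: ifPn => [_|t0]; first by rewrite normr1.
rewrite normrM normfV ler_pdivrMr ?mul1r ?normr_sin_le// normr_gt0 mulf_neq0//.
by rewrite gt_eqF// pi_gt0.
Qed.

(** The source of the gain of regularity, applied to t = v1.v2; for t nonzero the left-hand side is
    |sin (pi t)| / pi. *)
Lemma mul_sinc_le1 (t : R) : `|t| * `|sinc t| <= 1.
Proof.
rewrite /sinc; case: ifPn => [/eqP ->|t0]; first by rewrite normr0 mul0r.
have p0 : 0 < pi :> R := pi_gt0 R.
have p00 : pi != 0 :> R by rewrite gt_eqF.
rewrite -normrM (_ : t * _ = sin (pi * t) / pi);
  last by rewrite invfM [pi^-1 * _]mulrC mulrCA mulVKf.
rewrite normrM normfV (gtr0_norm p0) ler_pdivrMr// mul1r.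
apply: (@le_trans _ _ 1); last by have := @pi_ge2 R; lra.
exact: sin_max.
Qed.

Lemma normc_Theta (v : V) : normc (Theta v) = `|sinc (dot (lsubmx v) (rsubmx v))|.
Proof. exact: normc_real. Qed.

(** - J^-1 (u1, u2) = (u2, - u1) only changes the sign of u1.u2, and [sinc] is even. *)
Lemma Theta_symplectic_inv (u : V) : Theta (- symplectic_inv u) = Theta u.
Proof.
rewrite /Theta opp_row_mx row_mxKl row_mxKr opprK dotNr sinc_even.
by rewrite dotC.
Qed.

(** Writing 1/t as t (t^2)^-1 reduces the claim to a real power; at t = 0 both sides are 0. *)
Lemma measurable_invr : measurable_fun setT (fun t : R => t^-1).
Proof.
have -> : (fun t : R => t^-1) = (fun t => t * (t ^+ 2) `^ (-1)).
  apply/funext => t; rewrite powR_inv1 ?sqr_ge0//.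
  have [->|t0] := eqVneq t 0; first by rewrite invr0 mul0r.
  by field.
apply: measurable_funM => //.
by apply: (measurableT_comp (measurable_powR _)); exact: measurable_funX.
Qed.

Lemma measurable_sinc : measurable_fun setT (@sinc R).
Proof.
apply: measurable_fun_ifT.
- by apply: measurable_fun_eqr => //; exact: measurable_cst.
- exact: measurable_cst.
- apply: measurable_funM; first exact: measurable_sinZ.
  by apply: (measurableT_comp measurable_invr); exact: mulrl_measurable.
Qed.

Lemma cmeasurable_Theta : cmeasurable (@Theta R d).
Proof.
apply: cmeasurable_real; apply: (measurableT_comp measurable_sinc).
by apply: measurable_dot; [exact: measurable_lsubmx|exact: measurable_rsubmx].
Qed.

Lemma cintegrable_Theta_shift (phi : V -> R[i]) (h : V -> R) (w : V) :
  cmeasurable phi ->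
  measurable_fun setT h -> (forall u, normc (fourier phi u) <= h u) ->
  (\int[lebn (d + d)]_u (h u)%:E < +oo)%E ->
  cintegrable (lebn (d + d)) (fun v => Theta v * fourier phi (w - v)).
Proof.
move=> mphi mh fh hoo.
have h0 u : 0 <= h u by apply: le_trans (fh u); exact: normc_ge0.
apply: (@cintegrable_le _ _ _ _ _ (fun v : V => (h (w - v))%:E)).
- apply: cmeasurableM; first exact: cmeasurable_Theta.
  apply: (cmeasurable_comp _ (cmeasurable_fourier mphi)).
  by apply: measurable_rVD; [exact: measurable_cst|exact: measurable_rVN].
- move=> v; rewrite lee_fin normcM normc_Theta -[leRHS]mul1r.
  by rewrite ler_pM ?normc_ge0// sinc_le1.
- have mhE : measurable_fun setT (EFin \o h) by exact/measurable_EFinP.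
  by rewrite (ge0_integral_subr w mhE).
Qed.

(* The pairing is computed by moving the translation by x and the modulation by
   w onto [Theta], which is invariant under the symplectic map. *)
Lemma Theta_sigmaE (phi : V -> R[i]) (x w : V) (h : V -> R) :
  cintegrable (lebn (d + d)) phi ->
  measurable_fun setT h -> (forall u, normc (fourier phi u) <= h u) ->
  (\int[lebn (d + d)]_u (h u)%:E < +oo)%E ->
  Theta_sigma (fun y => phi (x + y) * wave w (x + y)) =
  fourier (fun v => Theta v * fourier phi (w - v)) x.
Proof.
move=> phii mh fh hoo; have [mphi _] := phii.
pose M v := Theta v * fourier phi (w - v).
have Mi : cintegrable (lebn (d + d)) M := cintegrable_Theta_shift w mphi mh fh hoo.
pose G v := wave x v * M v.
have Gi : cintegrable (lebn (d + d)) G by exact: cintegrable_wave.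
rewrite /Theta_sigma /distr_symplectic_fourier /distr_fourier /distr_of_fun.
rewrite -[LHS]/(cint (lebn (d + d)) _) -[RHS]/(cint (lebn (d + d)) G).
(* The substitution v = - J^-1 u in the right-hand side, as a reflection followed by J^-1; it leaves
   [Theta] unchanged. *)
have [Gi' <-] := cint_subr 0 Gi.
rewrite -(cint_symplectic 0 Gi'); apply: cint_ext => u.
rewrite !add0r /G /M Theta_symplectic_inv opprK mulrCA; congr (_ * _).
(* The integrand of the inner transform in the variable x + J^-1 y, whose inverse change is y |-> J
   (y - x). *)
pose g y := wave u (symplectic (y - x)) * (phi y * wave w y).
have gi : cintegrable (lebn (d + d)) g.
  apply: (cintegrableMb (K := 1)).
  - apply: cmeasurable_wave; first exact: measurable_cst.
    by apply: measurable_symplectic; apply: measurable_rVD => //;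
      exact: measurable_cst.
  - by move=> v; rewrite normc_wave.
  - have -> : (fun y => phi y * wave w y) = (fun y => wave w y * phi y) by
      apply/funext => y; rewrite mulrC.
    exact: cintegrable_wave.
transitivity (cint (lebn (d + d)) (fun y => g (x + symplectic_inv y))).
  by apply: cint_ext => y; rewrite /g [x + _ - x]addrC addrA addNr add0r
    symplectic_invK.
rewrite cint_symplectic// /fourier -[cintegral _]/(cint (lebn (d + d)) _).
rewrite cintZ; last exact: cintegrable_wave.
apply: cint_ext => y; rewrite /g -[expi _]/(wave (w + symplectic_inv u) y).
have -> : wave u (symplectic (y - x)) = wave (symplectic_inv u) y * wave x (-
  symplectic_inv u).
  rewrite /wave dot_symplectic dotBl [dot (- _) x]dotNl [dot _ x]dotC -expiD.
  by congr expi; ring.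
have -> : wave (w + symplectic_inv u) y = wave w y * wave (symplectic_inv u) y.
  by rewrite waveC waveD waveC [wave y (symplectic_inv u)]waveC.
by ring.
Qed.

End symplectic_fourier.

(** * Pairing a square integrable function with a Fourier transform *)

Section pairing.
Context {R : realType}.
Local Notation lebn := (@lebesgue_rV R).
Variable n : nat.
Local Notation V := ('rV[R]_n).
Implicit Types (g M : V -> R[i]).

(** For g in L^2 the truncations are in L^1 as well, so their transforms are convergent integrals to
    which [bessel] applies. *)
Definition truncate g (k : nat) (x : V) : R[i] := (rbump k.+1%:R^-1 x)%:C * g x.

Lemma cmeasurable_truncate g k : cmeasurable g -> cmeasurable (truncate g k).
Proof.
by move=> mg; apply: cmeasurableM => //; apply: cmeasurable_real;
  exact: measurable_rbump.
Qed.

Lemma normc_truncate_le g k x : normc (truncate g k x) <= normc (g x).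
Proof.
rewrite normcM normc_real ger0_norm ?rbump_ge0// ler_piMl ?normc_ge0//.
exact: rbump_le1.
Qed.

Lemma cintegrable_truncate g k : cmeasurable g ->
  (\int[lebn n]_x (normc (g x) ^+ 2)%:E < +oo)%E ->
  cintegrable (lebn n) (truncate g k).
Proof.
move=> mg goo; have k0 : 0 < k.+1%:R^-1 :> R by rewrite invr_gt0.
have [mB Boo] := cintegrable_rbump n k0.
apply: (cintegrable_le (h := fun x : V => (normc (g x) ^+ 2)%:E + (normc (rbump
  k.+1%:R^-1 x)%:C)%:E)%E).
- exact: cmeasurable_truncate.
- move=> x; rewrite -EFinD lee_fin normcM normc_real ger0_norm ?rbump_ge0//.
  have := rbump_ge0 k.+1%:R^-1 x; have := rbump_le1 k.+1%:R^-1 x.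
  move: (rbump _ x) (normc (g x)) => B c B1 B0.
  (* B c <= c^2 + B for 0 <= B <= 1: the difference is the mean of c^2 - c + 1 and c^2 with weights
     B and 1 - B. *)
  rewrite -subr_ge0 (_ : _ - _ = B * ((c - 2^-1) ^+ 2 + 3 / 4) + (1 - B) * c ^+ 2);
    last by field.
  have H1 := sqr_ge0 (c - 2^-1); have H2 := sqr_ge0 c.
  by apply: addr_ge0; apply: mulr_ge0; lra.
- rewrite ge0_integralD//; last 4 first.
  + by move=> x _; rewrite lee_fin sqr_ge0.
  + by apply/measurable_EFinP; apply: measurable_funX; exact: measurable_normc.
  + by move=> x _; rewrite lee_fin normc_ge0.
  + exact: measurable_normcE.
  exact: lte_add_pinfty.
Qed.

(** The multiplication formula moves the transform from M to the truncation of g. The rest is at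
    most [delta k], the integral of |g| |M^| (1 - rbump), which tends to 0 by dominated convergence
    as g and M^ are in L^2. Note that [delta] depends on M. *)
Lemma normc_pairing_le g M : cmeasurable g ->
  (\int[lebn n]_x (normc (g x) ^+ 2)%:E < +oo)%E ->
  cintegrable (lebn n) M -> (\int[lebn n]_x (normc (M x) ^+ 2)%:E < +oo)%E ->
  exists2 delta : R^nat, delta k @[k --> \oo] --> 0 & forall k,
  ((normc (cint (lebn n) (fun x => g x * fourier M x)))%:E <=
   \int[lebn n]_v (normc (M v) * normc (fourier (truncate g k) v))%:E + (delta
     k)%:E)%E.
Proof.
move=> mg goo Mi M2oo; have [mM _] := Mi.
have [K K0 HK] := @bessel R n.
pose a x := normc (g x) * normc (fourier M x).
have mfM := cmeasurable_fourier mM.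
have ma : measurable_fun setT a by apply: measurable_funM; exact: measurable_normc.
have a0 x : 0 <= a x by rewrite mulr_ge0 ?normc_ge0.
have ai : (lebn n).-integrable setT (EFin \o a).
  apply/integrableP; split; first exact/measurable_EFinP.
  apply: (@le_lt_trans _ _ (\int[lebn n]_x ((normc (g x) ^+ 2)%:E + (normc (fourier M
    x) ^+ 2)%:E))%E).
    apply: ge0_le_integralT => x; first exact: abse_ge0.
    have am (p q : R) : p * q <= p ^+ 2 + q ^+ 2 by have := sqr_ge0 (p - q);
      have := sqr_ge0 (p + q); nra.
    by rewrite /= ger0_norm// -EFinD lee_fin /a am.
  rewrite ge0_integralD//; last 4 first.
  - by move=> x _; rewrite lee_fin sqr_ge0.
  - by apply/measurable_EFinP; apply: measurable_funX; exact: measurable_normc.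
  - by move=> x _; rewrite lee_fin sqr_ge0.
  - by apply/measurable_EFinP; apply: measurable_funX; exact: measurable_normc.
  apply: lte_add_pinfty => //; apply: le_lt_trans (HK _ Mi) _.
  have Mfin : (\int[lebn n]_x (normc (M x) ^+ 2)%:E)%E \is a fin_num.
    by rewrite ge0_fin_numE// integral_ge0// => x _; rewrite lee_fin sqr_ge0.
  by rewrite -(fineK Mfin) -EFinM ltry.
pose b (k : nat) x := a x * (1 - rbump k.+1%:R^-1 x).
have mb k : measurable_fun setT (b k).
  apply: measurable_funM => //; apply: measurable_funB; first exact: measurable_cst.
  exact: measurable_rbump.
have b0 k x : 0 <= b k x by rewrite mulr_ge0// subr_ge0 rbump_le1.
have ba k x : b k x <= a x.
  by rewrite ler_piMr// gerBl rbump_ge0.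
have bi k : (lebn n).-integrable setT (EFin \o b k).
  apply: le_integrable ai => //; first exact/measurable_EFinP.
  by move=> x _; rewrite /= lee_fin !ger0_norm.
exists (fun k => \int[lebn n]_x b k x).
  have D : (fun k => \int[lebn n]_x (b k x)%:E)%E @ \oo --> (\int[lebn n]_x (cst 0 x
    : \bar R))%E.
    apply: (@dominated_cvg _ _ _ _ _ measurableT (fun k => EFin \o b k) (cst 0%E)
      (EFin \o a)) => //.
    - by move=> k; apply/measurable_EFinP.
    - move=> x _; apply: cvg_EFin; first by near=> k.
      rewrite [X in _ --> X](_ : 0 = a x * (1 - 1)); last by rewrite subrr mulr0.
      apply: cvgM; first exact: cvg_cst.
      by apply: cvgB; [exact: cvg_cst|exact: rbump_cvg].
    - by move=> k x _; rewrite /= ger0_norm// lee_fin.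
  by rewrite integral0 in D; exact: fine_cvg D.
move=> k; have gki := cintegrable_truncate k mg goo.
pose F1 x := truncate g k x * fourier M x.
pose F2 x := (1 - rbump k.+1%:R^-1 x)%:C * (g x * fourier M x).
have mB : cmeasurable (fun x : V => (1 - rbump k.+1%:R^-1 x)%:C).
  apply: cmeasurable_real; apply: measurable_funB; first exact: measurable_cst.
  exact: measurable_rbump.
have F1i : cintegrable (lebn n) F1.
  apply: (cintegrable_le (h := EFin \o a)).
  - by apply: cmeasurableM => //; exact: cmeasurable_truncate.
  - move=> x; rewrite /= lee_fin normcM /a ler_wpM2r ?normc_ge0//.
    exact: normc_truncate_le.
  - have /integrableP[_] := ai; apply: le_lt_trans; apply: ge0_le_integralT => x /=.
      by rewrite lee_fin.
    by rewrite lee_fin ler_norm.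
have F2n x : normc (F2 x) = b k x.
  rewrite !normcM normc_real ger0_norm ?subr_ge0 ?rbump_le1//.
  by rewrite mulrC.
have F2i : cintegrable (lebn n) F2.
  apply: (cintegrable_le (h := EFin \o b k)).
  - by apply: cmeasurableM => //; exact: cmeasurableM.
  - by move=> x; rewrite F2n.
  - have /integrableP[_] := bi k; apply: le_lt_trans; apply: ge0_le_integralT => x /=.
      by rewrite lee_fin.
    by rewrite lee_fin ler_norm.
have -> : cint (lebn n) (fun x => g x * fourier M x) = cint (lebn n) F1 + cint (lebn
  n) F2.
  rewrite cintD//; apply: cint_ext => x; rewrite /F1 /F2 /truncate.
  by rewrite rmorphB rmorph1; ring.
apply: (@le_trans _ _ ((normc (cint (lebn n) F1))%:E + (normc (cint (lebn n)
  F2))%:E)%E).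
  by rewrite -EFinD lee_fin le_normcD.
apply: leeD.
  rewrite /F1 cint_fourier//; apply: le_trans (normc_cint_le _ _) _.
    by apply: cmeasurableM => //; apply: cmeasurable_fourier; case: gki.
  by apply: ge0_le_integralT => v; rewrite ?lee_fin ?normc_ge0// normcM.
apply: le_trans (normc_cint_le _ _) _; first by case: F2i.
rewrite /Rintegral fineK; last exact: integrable_fin_num (bi k).
by apply: ge0_le_integralT => v; rewrite ?lee_fin ?normc_ge0// F2n.
Unshelve. all: by end_near. Qed.

Lemma sqr_le_limn_einf (a : R) (I : (\bar R)^nat) (delta : R^nat) : 0 <= a ->
  (forall k, 0 <= I k)%E -> delta k @[k --> \oo] --> 0 ->
  (forall k, a%:E <= I k + (delta k)%:E)%E ->
  ((a ^+ 2)%:E <= limn_einf (fun k => I k ^+ 2))%E.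
Proof.
move=> a0 I0 d0 aI.
(* The signed square t |t| of t = a - delta k is at most I^2 even for negative t, where t^2 could
   exceed it. *)
have c : (a - delta k) * `|a - delta k| @[k --> \oo] --> a ^+ 2.
  have cd : (a - delta k) @[k --> \oo] --> a.
    by rewrite -[X in _ --> X]subr0; apply: cvgB => //; exact: cvg_cst.
  have -> : a ^+ 2 = a * `|a| by rewrite ger0_norm.
  by apply: cvgM => //; exact: cvg_norm.
have <- : limn_einf (fun k => ((a - delta k) * `|a - delta k|)%:E) = (a ^+ 2)%:E.
  by apply: cvg_limn_einf; apply: cvg_EFin => //; near=> k.
apply: le_limn_einf => k; have := aI k; have := I0 k.
case: (I k) => [r| _ _|]; [|by rewrite expe2 mulyy leey|by []].
rewrite -EFin_expe -EFinD !lee_fin => r0 ar.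
have [d0'|d0'] := leP 0 (a - delta k).
  by rewrite ger0_norm// -expr2 lerXn2r ?nnegrE// lerBlDr.
by rewrite (le_trans _ (sqr_ge0 r))// nmulr_rle0.
Unshelve. all: by end_near. Qed.

End pairing.

(** * Decay of Theta in a cone *)

Section cone.
Context {R : realType}.
Variable d : nat.
Local Notation V := ('rV[R]_(d + d)).

Definition pdot (w : V) : R := dot (lsubmx w) (rsubmx w).

(** Expand |l x - s y|^2 >= 0, with s = 1 or s = -1 according to the sign of x.y. *)
Lemma dot_young n (l : R) (x y : 'rV[R]_n) : 0 < l ->
  2 * `|dot x y| <= l * dot x x + l^-1 * dot y y.
Proof.
move=> l0; have l00 : l != 0 by rewrite gt_eqF.
have H s : s ^+ 2 = 1 -> 0 <= l * dot x x + l^-1 * dot y y - 2 * (s * dot x y).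
  move=> s1; have : 0 <= l^-1 * dot (l *: x - s *: y) (l *: x - s *: y).
    by rewrite mulr_ge0 ?dot_ge0// invr_ge0 ltW.
  rewrite dotBl !dotBr !dotZl !dotZr [dot y x]dotC.
  rewrite (_ : l^-1 * _ = l * dot x x + s ^+ 2 * (l^-1 * dot y y) - 2 * (s * dot x
    y)); last by field.
  by rewrite s1 mul1r.
have [xy|xy] := leP 0 (dot x y).
  by rewrite ger0_norm//; have := H 1 (expr1n _ _); rewrite mul1r; lra.
rewrite ltr0_norm//; have := H (-1); rewrite mulN1r sqrrN expr1n => /(_ erefl); lra.
Qed.

Lemma dot_split (w : V) :
  dot w w = dot (lsubmx w) (lsubmx w) + dot (rsubmx w) (rsubmx w).
Proof. exact: dot_row_mx. Qed.

Lemma pdotB (w e : V) : pdot (w - e) =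
  pdot w - dot (lsubmx w) (rsubmx e) - dot (rsubmx w) (lsubmx e) + dot (lsubmx e)
    (rsubmx e).
Proof.
rewrite /pdot !linearB/= !dotBl !dotBr [dot (rsubmx w) _]dotC.
by ring.
Qed.

(** In the expansion of v1.v2 for v = w - e, Young's inequality with parameter c lets the cross
    terms w1.e2 and w2.e1 consume exactly half of c |w|^2, at the price of |e|^2 / (2 c); the term
    e1.e2 costs |e|^2 / 2. *)
Lemma pdot_sub_ge (c : R) (w v : V) : 0 < c -> c * dot w w < `|pdot w| ->
  c / 2 * dot w w <= `|pdot v| + (c^-1 + 1) / 2 * dot (w - v) (w - v).
Proof.
move=> c0 cw; pose e := w - v.
have vE : pdot v = pdot w - dot (lsubmx w) (rsubmx e) - dot (rsubmx w) (lsubmx e) +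
  dot (lsubmx e) (rsubmx e).
  by rewrite -pdotB /e opprB addrC subrK.
have y1 := dot_young (lsubmx w) (rsubmx e) c0.
have y2 := dot_young (rsubmx w) (lsubmx e) c0.
have y3 := dot_young (lsubmx e) (rsubmx e) ltr01.
rewrite invr1 !mul1r in y3.
rewrite vE; move: cw y1 y2 y3; rewrite -/e (dot_split w) (dot_split e).
set A := pdot w; set B := dot (lsubmx w) (rsubmx e);
  set C := dot (rsubmx w) (lsubmx e).
set D := dot (lsubmx e) (rsubmx e).
have : `|A| <= `|A - B - C + D| + `|B| + `|C| + `|D|.
  rewrite {1}(_ : A = (A - B - C + D) + B + C - D); last by ring.
  apply: le_trans (ler_normB _ _) _; rewrite lerD2r.
  apply: le_trans (ler_normD _ _) _; rewrite lerD2r.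
  exact: ler_normD.
lra.
Qed.

(** Multiply [pdot_sub_ge] by |Theta(v)|: its first term is bounded by [mul_sinc_le1], its second by
    [sinc_le1]. Solving for |w|^2 brings in the factor 2/c. *)
Lemma Theta_decay (c : R) : 0 < c -> exists2 K, 0 < K &
  forall w v : V, c * dot w w < `|pdot w| ->
  (1 + dot w w) * normc (Theta v) <= K * (1 + dot (w - v) (w - v)).
Proof.
move=> c0; pose k := (c^-1 + 1) / 2.
have ci : 0 < c^-1 by rewrite invr_gt0.
have k0 : 0 < k by rewrite /k; lra.
have kc0 : 0 < 2 / c * (1 + k) by rewrite mulr_gt0 ?divr_gt0//; lra.
exists (1 + 2 / c * (1 + k)); first by lra.
move=> w v cw; have := pdot_sub_ge v c0 cw; rewrite -/k normc_Theta -/(pdot v).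
have := sinc_le1 (pdot v); have := mul_sinc_le1 (pdot v).
have := dot_ge0 (w - v); have := normr_ge0 (sinc (pdot v));
  have := normr_ge0 (pdot v).
move: (dot (w - v) _) (`|sinc _|) (`|pdot v|) (dot_ge0 w) => E T Q W0 Q0 T0 E0 QT T1
  H.
have H1 : c / 2 * dot w w * T <= 1 + k * E.
  have kE : 0 <= k * E by rewrite mulr_ge0// ltW.
  by apply: le_trans (ler_wpM2r T0 H) _; rewrite mulrDl lerD// ler_piMr.
have H2 : dot w w * T <= 2 / c * (1 + k * E).
  have c2 : 0 < 2 / c by rewrite divr_gt0.
  rewrite -(ler_pM2l (_ : 0 < c / 2)) ?divr_gt0// mulrA; apply: le_trans H1 _.
  by rewrite mulrA (_ : c / 2 * (2 / c) = 1) ?mul1r//; field; rewrite gt_eqF.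
have H3 : 2 / c * (1 + k * E) <= 2 / c * ((1 + k) * (1 + E)).
  by rewrite ler_pM2l ?divr_gt0//; nra.
rewrite mulrDl mul1r; apply: (@le_trans _ _ (1 + 2 / c * ((1 + k) * (1 + E)))).
  by apply: lerD => //; exact: le_trans H2 H3.
rewrite [leRHS]mulrDl mul1r mulrA lerD2r; lra.
Qed.

Lemma continuous_dot m (f g : V -> 'rV[R]_m) :
  (forall i, continuous (fun x => f x ord0 i)) ->
  (forall i, continuous (fun x => g x ord0 i)) ->
  continuous (fun x => dot (f x) (g x)).
Proof.
move=> cf cg; rewrite /dot; apply: continuous_big => [p|i _];
  first exact: add_continuous.
by move=> x; apply: (@continuousM _ V _ _ x); [exact: cf|exact: cg].
Qed.

Lemma open_cone (c : R) : open [set w : V | c * dot w w < `|pdot w|].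
Proof.
have cd : continuous (fun w : V => dot w w).
  by apply: continuous_dot => i; exact: coord_continuous.
have cp : continuous pdot.
  by apply: continuous_dot => i; under eq_fun do rewrite mxE; exact: coord_continuous.
have -> : [set w : V | c * dot w w < `|pdot w|] =
    (fun w => `|pdot w| - c * dot w w) @^-1` [set t | 0 < t].
  by apply/seteqP; split => w /=; rewrite subr_gt0.
apply: open_comp; last exact: open_gt.
move=> w _.
pose N (t : R) := `|t|.
have cn : {for w, continuous (fun w : V => `|pdot w|)}.
  apply: (@cvg_comp _ _ _ pdot N _ (nbhs (pdot w)));
    [exact: cp|exact: norm_continuous].
have cc : {for w, continuous (fun w : V => c * dot w w)}.
  by apply: (@continuousM _ V (fun=> c) _ w); [exact: cst_continuous|exact: cd].
exact: (@continuousB _ _ V _ _ w cn cc).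
Qed.

End cone.

(** * Absorbing the Sobolev weight into the tensor majorant *)

Section weight.
Context {R : realType}.
Local Notation leb := (@lebesgue_measure R).
Local Notation lebn := (@lebesgue_rV R).

(** The left-hand side is part of the expansion of the product, whose terms are nonnegative; the
    weight thereby takes the tensor form of [rbump_maj]. *)
Lemma oneD_dot_le n (u : 'rV[R]_n) : 1 + dot u u <= \prod_i (1 + u ord0 i ^+ 2).
Proof.
rewrite /dot; suff : 0 <= \sum_i u ord0 i * u ord0 i /\
  1 + \sum_i u ord0 i * u ord0 i <= \prod_i (1 + u ord0 i ^+ 2) by case.
elim/big_rec2 : _ => [|i p s _ [s0 sp]]; first by rewrite addr0.
have := sqr_ge0 (u ord0 i); rewrite -expr2; move: (u ord0 i ^+ 2) => a a0.
by split; [rewrite addr_ge0|nra].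
Qed.

Definition weight_maj (c : R) n (u : 'rV[R]_n) : R :=
  \prod_i (c * (1 + u ord0 i ^+ 2)^-1).

Lemma weight_maj_ge0 c n (u : 'rV[R]_n) : 0 <= c -> 0 <= weight_maj c u.
Proof.
by move=> c0; apply: prodr_ge0 => i _; rewrite mulr_ge0// invr_ge0 ltW// oneDsqr_gt0.
Qed.

Lemma measurable_weight_maj c n : measurable_fun setT (@weight_maj c n).
Proof.
apply: measurable_prodR => i; apply: measurable_funM; first exact: measurable_cst.
exact: (measurableT_comp measurable_oneDsqrV (measurable_coord i)).
Qed.

Lemma integral_weight_maj c n : 0 <= c ->
  (\int[lebn n]_u (weight_maj c u)%:E < +oo)%E.
Proof.
move=> c0; have [K K0 KE] := @oneDsqr_int R.
rewrite (ge0_integral_tensor (g := fun=> fun t => c * (1 + t ^+ 2)^-1) (c := fun=> c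
  * K)) ?ltry//.
- by move=> i; apply: measurable_funM;
    [exact: measurable_cst|exact: measurable_oneDsqrV].
- by move=> i t; rewrite mulr_ge0// invr_ge0 ltW// oneDsqr_gt0.
- move=> i; rewrite EFinM -KE -ge0_integralZl_EFin//.
  + by move=> t _; rewrite lee_fin invr_ge0 ltW// oneDsqr_gt0.
  + by apply/measurable_EFinP; exact: measurable_oneDsqrV.
Qed.

(** As e <= 1, 1 + s^2 <= 1 + (s/e)^2. In each coordinate one of the two factors of the majorant
    cancels the weight and the other is at most (1 + s^2)^-1. *)
Lemma weight_majP (C e : R) n (u : 'rV[R]_n) : 0 <= C -> 0 < e -> e <= 1 ->
  (1 + dot u u) * rbump_maj C e u <= weight_maj (C / e) u.
Proof.
move=> C0 e0 e1; apply: (@le_trans _ _ (\prod_i (1 + u ord0 i ^+ 2) * rbump_maj C e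
  u)).
  by rewrite ler_wpM2r ?rbump_maj_ge0// oneD_dot_le.
rewrite -big_split/=; apply: ler_prod => i _.
set s := u ord0 i; have s0 := oneDsqr_gt0 s; have se0 := oneDsqr_gt0 (s / e).
rewrite mulr_ge0 ?bump_maj_ge0 ?(ltW s0)//= /bump_maj.
have -> : (1 + s ^+ 2) * (e^-1 * (C / (1 + (s / e) ^+ 2) ^+ 2)) =
    C / e * ((1 + s ^+ 2) / (1 + (s / e) ^+ 2) ^+ 2).
  by move: ((1 + (s / e) ^+ 2) ^+ 2)^-1 e^-1 => a b; ring.
rewrite ler_wpM2l ?divr_ge0 ?(ltW e0)// ler_pdivrMr ?exprn_gt0// mulrC ler_pdivlMr//
  -expr2.
rewrite lerXn2r ?nnegrE ?(ltW s0) ?(ltW se0)// lerD2l expr_div_n ler_pdivlMr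
  ?exprn_gt0//.
by rewrite ler_piMr ?sqr_ge0// exprn_ile1// ltW.
Qed.

End weight.

Lemma japanese_sqr (R : realType) n (w : 'rV[R]_n) : japanese w `^ 2 = 1 + dot w w.
Proof.
rewrite /japanese powR_mulrn ?sqrtr_ge0// sqr_sqrtr// addr_ge0//.
exact: dot_ge0.
Qed.

(** * Regularity of Qf at z in a cone around zeta *)

Theorem corollary1p3 (R : realType) (d : nat) (hd : (1 <= d)%N)
    (f : 'rV[R]_d -> R[i]) (hf : square_integrable f)
    (z zeta : 'rV[R]_(d + d))
    (hzeta : dot (lsubmx zeta) (rsubmx zeta) != 0) :
  ~ wave_front_Hs 2 (born_jordan f) (z, zeta).
Proof.
move=> [_]; apply => /=.
have [mre mim /L2norm_integral foo] := hf.
have mf : cmeasurable f by split.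
pose V := 'rV[R]_(d + d).
pose g : V -> R[i] := wigner f.
have mg : cmeasurable g by exact: cmeasurable_wigner.
have goo := integral_wigner_lty mf foo.
(* This dilation gives |e z_i| < 1, so the cut-off is positive at z, and e <= 1 as required by
   [weight_majP]. *)
pose e : R := (1 + \sum_i `|z ord0 i|)^-1.
have sz0 : 0 <= \sum_i `|z ord0 i| by exact: sumr_ge0.
have e0 : 0 < e by rewrite invr_gt0; lra.
have e1 : e <= 1 by rewrite invf_le1; lra.
pose phi (x : V) : R[i] := (rbump e x)%:C.
exists phi; first split; first exact: test_function_rbump.
  have : 0 < rbump e z.
    apply: prodr_gt0 => i _; apply: bump_gt0.
    rewrite normrM (gtr0_norm e0) /e mulrC ltr_pdivrMr ?mul1r; last by lra.
    rewrite (bigD1 i)//=; have : 0 <= \sum_(j | j != i) `|z ord0 j| by exact: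
      sumr_ge0.
    lra.
  by rewrite /phi => r0; apply/eqP => -[r00]; rewrite r00 ltxx in r0.
pose q := `|pdot zeta|; have q0 : 0 < q by rewrite normr_gt0.
(* The denominator 1 + |zeta|^2 makes c |zeta|^2 < q strict; strictness keeps the cone open and
   excludes 0. *)
pose c := q / (1 + dot zeta zeta).
have dz := dot_ge0 zeta.
have c0 : 0 < c by rewrite divr_gt0//; lra.
exists [set w : V | c * dot w w < `|pdot w|].
  split.
  - exact: open_cone.
  - move=> t w t0 /=; rewrite /pdot !linearZ/= !(dotZl, dotZr) !normrM (gtr0_norm t0).
    by rewrite mulrCA ltr_pM2l// mulrCA ltr_pM2l.
  - by rewrite /= /pdot !linear0 !dot0l mulr0 normr0 ltxx.
  - rewrite /= /c mulrAC ltr_pdivrMr; last by lra.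
    by rewrite -/q ltr_pM2l//; lra.
have [C C0 BC] := @normc_fourier_rbump R.
have [S0 S00 HS] := integral_bump_maj (ltW C0).
have phii : cintegrable (lebesgue_rV (d + d)) phi by exact: cintegrable_rbump.
have [mphi phioo] := phii.
have BCe (u : V) : normc (fourier phi u) <= rbump_maj C e u by exact: BC.
have majoo : (\int[lebesgue_rV (d + d)]_u (rbump_maj C e u)%:E < +oo)%E.
  by rewrite (integral_rbump_maj _ (ltW C0) HS) ?ltry.
(* By [Theta_sigmaE] the localised transform at w is the pairing of Wf with the Fourier transform of
   [M w]. *)
pose M (w v : V) := Theta v * fourier phi (w - v).
have Mi w : cintegrable (lebesgue_rV (d + d)) (M w).
  by apply: cintegrable_Theta_shift majoo => //; exact: measurable_rbump_maj.
have FE w : fourier_compact (distr_mul phi (born_jordan f)) w =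
    cint (lebesgue_rV (d + d)) (fun x => g x * fourier (M w) x).
  apply: cint_ext => x; congr (_ * _).
  by apply: Theta_sigmaE majoo => //; exact: measurable_rbump_maj.
(* [M w] is bounded by the L^1 norm of [phi], and a bounded integrable function is square
   integrable. *)
have M2oo w : (\int[lebesgue_rV (d + d)]_v (normc (M w v) ^+ 2)%:E < +oo)%E.
  have phifin : (\int[lebesgue_rV (d + d)]_x (normc (phi x))%:E)%E \is a fin_num.
    by rewrite ge0_fin_numE// integral_ge0// => x _; rewrite lee_fin normc_ge0.
  pose m := fine (\int[lebesgue_rV (d + d)]_x (normc (phi x))%:E)%E.
  have m0 : 0 <= m by apply: fine_ge0; apply: integral_ge0 => x _;
    rewrite lee_fin normc_ge0.
  have Mm v : normc (M w v) <= m.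
    rewrite normcM normc_Theta -[leRHS]mul1r ler_pM ?normc_ge0 ?sinc_le1//.
    by rewrite -lee_fin fineK//; exact: normc_fourier_le.
  have [mM Moo] := Mi w.
  apply: (@le_lt_trans _ _ (\int[lebesgue_rV (d + d)]_v (m%:E * (normc (M w
    v))%:E))%E).
    apply: ge0_le_integralT => v; first by rewrite lee_fin sqr_ge0.
    by rewrite -EFinM lee_fin expr2 ler_wpM2r ?normc_ge0.
  have Mfin : (\int[lebesgue_rV (d + d)]_v (normc (M w v))%:E)%E \is a fin_num.
    by rewrite ge0_fin_numE// integral_ge0// => v _; rewrite lee_fin normc_ge0.
  rewrite ge0_integralZl_EFin//; last 2 first.
  - by move=> v _; rewrite lee_fin normc_ge0.
  - exact: measurable_normcE.
  by rewrite -(fineK Mfin) -EFinM ltry.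
have [K1 K10 HK1] := Theta_decay d c0.
(* For w in the cone, <w>^2 |M w v| <= Psi (w - v): a convolution kernel of finite integral. *)
pose Psi (u : V) := K1 * weight_maj (C / e) u.
have Ce0 : 0 <= C / e by rewrite divr_ge0// ltW.
have Psi0 u : 0 <= Psi u by rewrite mulr_ge0 ?weight_maj_ge0// ltW.
have mPsi : measurable_fun setT Psi.
  by apply: measurable_funM; [exact: measurable_cst|exact: measurable_weight_maj].
have Psioo : (\int[lebesgue_rV (d + d)]_u (Psi u)%:E < +oo)%E.
  have woo := integral_weight_maj (d + d) Ce0.
  have wfin : (\int[lebesgue_rV (d + d)]_u (weight_maj (C / e) u)%:E)%E \is a fin_num.
    by rewrite ge0_fin_numE// integral_ge0// => u _; rewrite lee_fin weight_maj_ge0.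
  under eq_integral do rewrite /Psi EFinM.
  rewrite ge0_integralZl_EFin ?(ltW K10)//; last 2 first.
  - by move=> u _; rewrite lee_fin weight_maj_ge0.
  - by apply/measurable_EFinP; exact: measurable_weight_maj.
  by rewrite -(fineK wfin) -EFinM ltry.
have Psifin : (\int[lebesgue_rV (d + d)]_u (Psi u)%:E)%E \is a fin_num.
  by rewrite ge0_fin_numE// integral_ge0// => u _; rewrite lee_fin.
(* The 1 makes S positive, since [schur_square] divides by it. *)
pose S := fine (\int[lebesgue_rV (d + d)]_u (Psi u)%:E)%E + 1.
have SPsi : (\int[lebesgue_rV (d + d)]_u (Psi u)%:E <= S%:E)%E.
  by rewrite /S EFinD fineK// leeDl.
have Sgt0 : 0 < S.
  by rewrite /S ltr_wpDl// fine_ge0// integral_ge0// => u _; rewrite lee_fin.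
pose H k (v : V) := normc (fourier (truncate g k) v).
have mH k : measurable_fun setT (H k).
  by apply: measurable_normc; apply: cmeasurable_fourier; exact: cmeasurable_truncate.
pose I k (w : V) := (\int[lebesgue_rV (d + d)]_v (Psi (w - v) * H k v)%:E)%E.
have PH0 k w v : (0 <= (Psi (w - v) * H k v)%:E)%E by rewrite lee_fin mulr_ge0//
  normc_ge0.
have I0 k w : (0 <= I k w)%E by exact: integral_ge0.
have mI k : measurable_fun setT (fun w => I k w ^+ 2)%E.
  have mIk : measurable_fun setT (I k).
    apply: (measurable_fun_fubini_tonelli_F (fun p : V * V => (Psi (p.1 - p.2) * H k
      p.2)%:E)).
      apply/measurable_EFinP; apply: measurable_funM; last exact: measurableT_comp.
      by apply: (measurableT_comp mPsi); apply: measurable_rVD => //;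
        exact: measurable_rVN.
    by move=> p; rewrite lee_fin mulr_ge0// normc_ge0.
  by under eq_fun do rewrite expe2; exact: emeasurable_funM.
(* The error [delta] depends on w, so the limit in k is taken inside the integral over w. *)
apply: (@L2norm_lty _ _ _ _ (fun w => limn_einf (fun k => I k w ^+ 2))%E).
- move=> w Gw; rewrite FE normcM normc_real japanese_sqr.
  set W := 1 + dot w w; have W0 : 0 <= W by rewrite addr_ge0// dot_ge0.
  rewrite (ger0_norm W0); have [delta d0 Hd] := normc_pairing_le mg goo (Mi w) (M2oo
    w).
  apply: (@sqr_le_limn_einf _ _ _ (fun k => W * delta k)) => //.
  + by rewrite mulr_ge0// normc_ge0.
  + rewrite -[X in _ --> X](mulr0 W); apply: cvgM => //; exact: cvg_cst.
  + move=> k; rewrite mulrC EFinM; apply: le_trans (lee_wpmul2l _ (Hd k)) _;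
      first by rewrite lee_fin.
    rewrite muleDr//; last exact: fin_num_adde_defl.
    rewrite -EFinM; apply: leeD => //.
    have mMH : measurable_fun setT (fun v => (normc (M w v) * H k v)%:E).
      apply/measurable_EFinP; apply: measurable_funM => //; apply: measurable_normc.
      by case: (Mi w).
    have -> : (W%:E * \int[lebesgue_rV (d + d)]_v (normc (M w v) * H k v)%:E =
        \int[lebesgue_rV (d + d)]_v (W%:E * (normc (M w v) * H k v)%:E))%E.
      apply/esym/ge0_integralZl_EFin => // v _.
      by rewrite lee_fin mulr_ge0// normc_ge0.
    apply: ge0_le_integralT => v; first by rewrite -EFinM lee_fin !mulr_ge0//
      normc_ge0.
    rewrite -EFinM lee_fin mulrA ler_wpM2r ?normc_ge0// normcM mulrA.
    (* The decay of [Theta] holds because w lies in the cone; v ranges over the whole space. *)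
    apply: le_trans (ler_pM _ _ (HK1 w v Gw) (BCe (w - v))) _.
    + by rewrite mulr_ge0 ?normc_ge0.
    + exact: normc_ge0.
    + rewrite -mulrA ler_wpM2l ?(ltW K10)//; exact: weight_majP (ltW C0) e0 e1.
- move=> w; rewrite -(cvg_limn_einf (@cvg_cst _ (0%E : \bar R) _ _ _)).
  by apply: le_limn_einf => k; exact: sqre_ge0.
(* After Fatou, every k has the same bound: Schur's test gives S^2, Bessel's inequality gives K, and
   a truncation has at most the norm of Wf. *)
- apply: (@le_lt_trans _ _ (limn_einf (fun k => \int[lebesgue_rV (d + d)]_w (I k w ^+
    2)))%E).
    apply: fatou => //; by move=> k w _; exact: sqre_ge0.
  have [K K0 HK] := @bessel R (d + d).
  have gfin : (\int[lebesgue_rV (d + d)]_x (normc (g x) ^+ 2)%:E)%E \is a fin_num.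
    by rewrite ge0_fin_numE// integral_ge0// => x _; rewrite lee_fin sqr_ge0.
  apply: (@le_lt_trans _ _ ((S * S)%:E * (K%:E * \int[lebesgue_rV (d + d)]_x (normc
    (g x) ^+ 2)%:E))%E); last first.
    by rewrite -(fineK gfin) -!EFinM ltry.
  apply: limn_einf_le => k.
  apply: le_trans (schur_square mPsi Psi0 SPsi Sgt0 (mH k) (fun=> normc_ge0 _)) _.
  apply: lee_wpmul2l; first by rewrite lee_fin mulr_ge0// ltW.
  apply: le_trans (HK _ (cintegrable_truncate k mg goo)) _.
  apply: lee_wpmul2l; first by rewrite lee_fin.
  apply: ge0_le_integralT => x; first by rewrite lee_fin sqr_ge0.
  by rewrite lee_fin lerXn2r ?nnegrE ?normc_ge0// normc_truncate_le.
Qed.
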